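(* The counting problem $\#\textsc{P-Tromino}_{n,n/3}$ is computable in $O(n)$ time: given a region $R$ with $n$ cells and a set $P$ of $n/3$ peg cells of $R$, the number of p-covers of $(R,P)$ can be computed in $O(n)$ time.
   Context: A cell is a unit square $[a,a+1]\times[b,b+1]$ with $a,b\in\mathbb Z$. A region $R$ is a finite union of cells whose interior is connected. Two cells are adjacent if their Manhattan distance is $1$. A tromino is an L-shaped polyomino of three cells: a corner cell together with two cells (tips) adjacent to it, one horizontally and one vertically. Given a region $R$ and a set $P$ of cells of $R$ carrying pegs, a p-tromino is a tromino with a hole in its corner cell; it may be placed in $R$ only with its corner cell on a cell of $P$, and pegs may only be occupied by holes. A p-cover of $(R,P)$ is a set of p-trominoes contained in $R$, pairwise non-overlapping, covering all cells of $R$, each with its corner cell on a peg cell and its tips on peg-free cells. $\#\textsc{P-Tromino}_{n,n/3}$ is the problem of counting the p-covers of a region with $n$ cells and $n/3$ pegs. *)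

(* Defs.v *)
From HB Require Import structures.
From mathcomp Require Import all_boot all_order all_algebra.
From mathcomp Require Import finmap.
From mathcomp Require Import all_classical all_reals all_analysis.
Set Implicit Arguments.
Unset Strict Implicit.
Unset Printing Implicit Defensive.
Import Order.TTheory GRing.Theory Num.Theory.
Import numFieldNormedType.Exports.
Local Open Scope ring_scope.

(* The cell [a, a+1] x [b, b+1] is represented by its lower left corner
   (a, b); [square] is the cell as a subset of the plane. *)
Definition cell := (int * int)%type.

Definition square (R : realType) (c : cell) : set (R * R) :=
  [set z : R * R | c.1%:~R <= z.1 <= (c.1 + 1)%:~R /\
                   c.2%:~R <= z.2 <= (c.2 + 1)%:~R]%classic.

Definition region (R : realType) (S : {fset cell}) : Prop :=
  connected (interior (\bigcup_(c in [set` S]) @square R c)%classic).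

Definition adjacent_cells (c d : cell) : bool :=
  (`|c.1 - d.1| + `|c.2 - d.2| == 1)%N.

(* (corner, horizontal tip, vertical tip): since the tips are listed in this
   order, each placed L-tromino has exactly one representation. *)
Definition tromino := (cell * cell * cell)%type.

Definition corner (t : tromino) : cell := t.1.1.
Definition htip (t : tromino) : cell := t.1.2.
Definition vtip (t : tromino) : cell := t.2.

Definition is_tromino (t : tromino) : bool :=
  [&& adjacent_cells (corner t) (htip t), (htip t).2 == (corner t).2,
      adjacent_cells (corner t) (vtip t) & (vtip t).1 == (corner t).1].

Definition tromino_cells (t : tromino) : {fset cell} :=
  [fset corner t; htip t; vtip t]%fset.

Definition p_placeable (S P : {fset cell}) (t : tromino) : Prop :=
  [/\ is_tromino t, (tromino_cells t `<=` S)%fset, corner t \in P,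
      htip t \notin P & vtip t \notin P].

Definition p_cover (S P : {fset cell}) (C : {fset tromino}) : Prop :=
  [/\ forall t : tromino, t \in C -> p_placeable S P t,
      forall t u : tromino, t \in C -> u \in C -> t != u ->
        [disjoint tromino_cells t & tromino_cells u]%fset
    & forall c : cell, c \in S ->
        exists2 t : tromino, t \in C & c \in tromino_cells t].

(* The p-covers of (S, P) are sets of triples of cells of S, so none is lost
   by ranging over the subsets of S x S x S. *)
Definition num_p_covers (S P : {fset cell}) : nat :=
  #|` [fset C in fpowerset (S `*` S `*` S) | `[< p_cover S P C >]] |%fset.

Definition peg_instance := ({fset cell} * {fset cell})%type.

Definition ptromino_n_n3 (R : realType) (I : peg_instance) : Prop :=
  [/\ region R I.1, (I.2 `<=` I.1)%fset & #|` I.1 | = (3 * #|` I.2 |)%N].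

(* Random access machine whose words are integers: registers are named by the
   program, memory cells are addressed by words, and the machine halts when
   the program counter leaves the program.  Memory that does not hold the input
   is initially 0.  Every instruction costs one step;
   the size of the words is bounded in [computes_within] below. *)
Inductive instr : Type :=
| Const of nat & int            (* r <- z *)
| Add of nat & nat & nat        (* r <- s + t *)
| Sub of nat & nat & nat        (* r <- s - t *)
| Mul of nat & nat & nat        (* r <- s * t *)
| Read of nat & nat             (* r <- mem[s] *)
| Write of nat & nat            (* mem[r] <- s *)
| JumpLe of nat & nat & nat.    (* if r <= s go to instruction l *)

Record config := Config { pc : nat; reg : nat -> int; memory : int -> int }.

Definition set_reg (c : config) (r : nat) (z : int) : config :=
  Config (pc c).+1 [eta reg c with r |-> z] (memory c).

Definition exec (i : instr) (c : config) : config :=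
  match i with
  | Const r z => set_reg c r z
  | Add r s t => set_reg c r (reg c s + reg c t)
  | Sub r s t => set_reg c r (reg c s - reg c t)
  | Mul r s t => set_reg c r (reg c s * reg c t)
  | Read r s => set_reg c r (memory c (reg c s))
  | Write r s =>
      Config (pc c).+1 (reg c) [eta memory c with reg c r |-> reg c s]
  | JumpLe r s l =>
      Config (if reg c r <= reg c s then l else (pc c).+1) (reg c) (memory c)
  end.

Definition program := seq instr.

Definition step (p : program) (c : config) : config :=
  if onth p (pc c) is Some i then exec i c else c.

Definition halted (p : program) (c : config) : bool := (size p <= pc c)%N.

Definition initial (w : seq int) : config :=
  Config 0 (fun=> 0) (fun a => if 0 <= a then nth 0 w `|a|%N else 0).

(* The result may be exponential in n and hence need linearly many words: it is
   output in binary, least significant digit first and without leading zeros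
   (so that 0 has no digit). *)
Definition binary (ds : seq nat) (N : nat) : Prop :=
  [/\ all (fun d => d < 2)%N ds, last 1%N ds = 1%N
    & N = (\sum_(i < size ds) nth 0 ds i * 2 ^ i)%N].

Definition outputs (c : config) (N : nat) : Prop :=
  exists2 ds : seq nat, binary ds N &
    memory c 0 = (size ds)%:Z /\
    forall i, (i < size ds)%N -> memory c i.+1%:Z = (nth 0%N ds i)%:Z.

Definition words_bounded (B : nat) (c : config) : Prop :=
  (forall r, `|reg c r| <= B)%N /\ (forall a, `|memory c a| <= B)%N.

(* On input w, the program halts after at most t steps with output N, and all
   words occurring in the run are polynomially bounded (with exponent d) in
   the words of the input, that is, have logarithmic length. *)
Definition computes_within (p : program) (d t : nat) (w : seq int) (N : nat) :
    Prop :=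
  let run k := iter k (step p) (initial w) in
  [/\ halted p (run t), outputs (run t) N
    & forall k, words_bounded ((\max_(x <- w) `|x|%N + 2) ^ d) (run k)].

(* [enc x w] means that w is an encoding of the instance x; there may be
   several, and the program has to succeed on each of them. *)
Definition computable_in_time (X : Type) (valid : X -> Prop)
    (enc : X -> seq int -> Prop) (sz f : X -> nat) (T : nat -> nat) : Prop :=
  exists (p : program) (d : nat), forall (x : X) (w : seq int),
    valid x -> enc x w -> computes_within p d (T (sz x)) w (f x).

Definition encode_cells (s : seq cell) : seq int :=
  (size s)%:Z :: flatten [seq [:: c.1; c.2] | c <- s].

(* The cells of the region and the pegs are listed in any order. *)
Definition encodes (I : peg_instance) (w : seq int) : Prop :=
  exists s p : seq cell,
    [/\ perm_eq s I.1, perm_eq p I.2 & w = encode_cells s ++ encode_cells p].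

(* Main.v *)
(** A peg [p] must receive a tromino whose horizontal tip is the left or the right
    neighbour of [p] and whose vertical tip is the upper or the lower one.  Take the
    peg-free cells as vertices and, for every peg, one edge (a "slot") joining the two
    candidates for its horizontal tip and one joining those for its vertical tip: a
    p-cover chooses one end of each edge so that every vertex is chosen exactly once.
    There are as many edges as vertices.  A vertex of degree 0 excludes any p-cover; a
    vertex of degree 1 determines the end of its edge, so both can be deleted.  When no
    vertex of degree 1 is left and there is none of degree 0, double counting shows that
    all vertices have degree 2, so that the graph is a union of disjoint cycles, each of
    which can be oriented in two ways.  Hence the number of p-covers is 0 or 2^k, where
    k is the number of cycles.

    Deleting a vertex of degree 1 changes the degree of the other end of its edge only,
    so the machine scans the list of cells and follows chains of forced deletions; a
    second scan opens each cycle once, counts it, and deletes the rest of it as a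
    chain.  A direct-address table, with addresses quadratic in a number K that exceeds
    the coordinates, is available because the memory is initially 0; K is computed as a
    sum of squares of input words, which avoids absolute values. *)

Require Import Defs.
From HB Require Import structures.
From mathcomp Require Import all_boot all_order all_algebra.
From mathcomp Require Import finmap.
From mathcomp Require Import all_classical all_reals all_analysis.
From mathcomp Require Import zify ring.
Import Order.TTheory GRing.Theory Num.Theory.
Import numFieldNormedType.Exports.
Set Implicit Arguments.
Unset Strict Implicit.
Unset Printing Implicit Defensive.
Local Open Scope classical_set_scope.
Local Open Scope ring_scope.

(** * Timed execution of structured programs *)

(** Registers form a list with default value 0 rather than a function, so that running a concrete
    block on an explicit list is a matter of conversion. *)
Definition state := (seq int * (int -> int))%type.

Definition upd (m : int -> int) (a v : int) : int -> int :=
  fun x => if x == a then v else m x.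

Definition exec1 (s : state) (i : instr) : state :=
  let l := s.1 in let m := s.2 in
  match i with
  | Const r z => (set_nth 0 l r z, m)
  | Add r u v => (set_nth 0 l r (nth 0 l u + nth 0 l v), m)
  | Defs.Sub r u v => (set_nth 0 l r (nth 0 l u - nth 0 l v), m)
  | Mul r u v => (set_nth 0 l r (nth 0 l u * nth 0 l v), m)
  | Read r u => (set_nth 0 l r (m (nth 0 l u)), m)
  | Write r u => (l, upd m (nth 0 l r) (nth 0 l u))
  | JumpLe _ _ _ => s
  end.

(* The bound 4 on constants lets a word bound square at each instruction. *)
Definition straight (i : instr) : bool :=
  match i with Const _ z => (`|z| <= 4)%N | JumpLe _ _ _ => false | _ => true end.

Definition conf (k : nat) (s : state) := Config k (nth 0 s.1) s.2.

Definition bounded (X : nat) (s : state) : Prop :=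
  all (fun z : int => `|z| <= X)%N s.1 /\ forall a, (`|s.2 a| <= X)%N.

Lemma bounded_nth X s r : bounded X s -> (`|nth 0%R s.1 r| <= X)%N.
Proof.
move=> [/allP sX _]; have [rs|rs] := ltnP r (size s.1).
  exact/sX/mem_nth.
by rewrite nth_default.
Qed.

Lemma bounded_leq X Y s : (X <= Y)%N -> bounded X s -> bounded Y s.
Proof.
move=> XY [/allP s1 s2]; split; first by apply/allP => z /s1 /leq_trans; apply.
by move=> a; apply: leq_trans XY.
Qed.

Lemma bounded_words X s k : bounded X s -> words_bounded X (conf k s).
Proof. by move=> sX; split=> [r|a]; [exact: bounded_nth|exact: sX.2]. Qed.

Lemma all_set_nth X l r (z : int) : all (fun z : int => `|z| <= X)%N l ->
  (`|z| <= X)%N -> all (fun z : int => `|z| <= X)%N (set_nth 0 l r z).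
Proof.
move=> lX zX; apply/(all_nthP 0) => i; rewrite nth_set_nth /= => _.
case: eqP => // _; have [il|il] := ltnP i (size l); last by rewrite nth_default.
by move/(all_nthP 0): lX; apply.
Qed.

Lemma leq_absz_add (x y : int) A B : (`|x| <= A)%N -> (`|y| <= B)%N -> (`|(x + y)%R| <= A + B)%N.
Proof. lia. Qed.

Lemma leq_absz_sub (x y : int) A B : (`|x| <= A)%N -> (`|y| <= B)%N -> (`|(x - y)%R| <= A + B)%N.
Proof. lia. Qed.

Lemma bounded_exec1 X s i : (1 < X)%N -> straight i -> bounded X s ->
  bounded (X ^ 2) (exec1 s i).
Proof.
move=> X1 si sX.
have XX : (X <= X ^ 2)%N by rewrite -[leqLHS]expn1 leq_exp2l.
have XX2 : (X + X <= X ^ 2)%N by rewrite addnn -muln2 -mulnn leq_mul2l X1 orbT.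
have XX4 : (4 <= X ^ 2)%N by rewrite (leq_exp2r 2 X (e:=2)).
have [s1 s2] := bounded_leq XX sX.
have nthX r := bounded_nth r sX.
case: i si => //= [r z|r u v|r u v|r u v|r u|r u] si; split=> //=; try exact: all_set_nth.
- by apply: all_set_nth => //; apply: leq_trans XX4.
- by apply: all_set_nth => //; apply: leq_trans (leq_absz_add _ _) XX2.
- by apply: all_set_nth => //; apply: leq_trans (leq_absz_sub _ _) XX2.
- apply: all_set_nth => //; rewrite abszM; apply: leq_mul; exact: nthX.
- by move=> a; rewrite /upd; case: eqP => // _; apply: leq_trans (nthX _) XX.
Qed.

Lemma step_conf p k s i : onth p k = Some i -> straight i ->
  step p (conf k s) = conf k.+1 (exec1 s i).
Proof.
move=> pk; rewrite /step /= pk; case: i {pk} => //= *; rewrite /conf /set_reg /=;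
  congr Config; apply/funext => x; by rewrite nth_set_nth.
Qed.

(** The word bound concerns every intermediate configuration, because [computes_within] asks for it
    along the whole run. *)
Definition steps (p : program) (Y t : nat) (c c' : config) :=
  iter t (step p) c = c' /\
  forall j, (j <= t)%N -> words_bounded Y (iter j (step p) c).

Lemma steps0 p Y c : words_bounded Y c -> steps p Y 0 c c.
Proof. by move=> cY; split=> // -[|]. Qed.

Lemma steps1 p Y c : words_bounded Y c -> words_bounded Y (step p c) ->
  steps p Y 1 c (step p c).
Proof. by move=> cY cY'; split=> // -[|[|]]. Qed.

Lemma steps_trans p Y t1 t2 c1 c2 c3 : steps p Y t1 c1 c2 ->
  steps p Y t2 c2 c3 -> steps p Y (t1 + t2) c1 c3.
Proof.
move=> [<- h1] [<- h2]; split; first by rewrite addnC iterD.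
move=> j jt; have [/h1//|t1j] := leqP j t1.
rewrite -(subnK (ltnW t1j)) iterD; apply: h2; lia.
Qed.

(** * Structured programs and the cost of loops *)

Definition exec_block (b : seq instr) (s : state) : state := foldl exec1 s b.

Inductive com :=
| Block of seq instr
| Seq of com & com
| While of nat & nat & com.

(* [While r s c] repeats [c] as long as [r <= s]; the tests [0 <= 0] are
   unconditional jumps. *)
Fixpoint compile (o : nat) (c : com) : program :=
  match c with
  | Block b => b
  | Seq c1 c2 => let p1 := compile o c1 in p1 ++ compile (o + size p1) c2
  | While r s c =>
      let p := compile o.+2 c in
      [:: JumpLe r s o.+2, JumpLe 0 0 (o + size p + 3) & rcons p (JumpLe 0 0 o)]
  end.

(* [X] bounds the words at the boundaries of blocks, and its iterated squares
   bound them inside a block of length at most [L]. *)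
Definition exe (X L : nat) (c : com) (s : state) (t : nat) (s' : state) :=
  forall pre post, let code := compile (size pre) c in
  steps (pre ++ code ++ post) (X ^ (2 ^ L)) t
    (conf (size pre) s) (conf (size pre + size code) s').

Definition guard (r r' : nat) (s : state) : bool := nth 0 s.1 r <= nth 0 s.1 r'.

Lemma step_jump p k r r' l s : onth p k = Some (JumpLe r r' l) ->
  step p (conf k s) = conf (if guard r r' s then l else k.+1) s.
Proof. by move=> pk; rewrite /step /= pk. Qed.

Lemma onth_size_cat (T : Type) (u v : seq T) k : onth (u ++ v) (size u + k) = onth v k.
Proof. by rewrite onth_cat ltnNge leq_addr /= addKn. Qed.

Section Exe.
Variables (X L : nat).
Hypothesis X1 : (1 < X)%N.

Let Y1 : (X <= X ^ (2 ^ L))%N.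
Proof. by rewrite -[leqLHS]expn1 leq_exp2l // expn_gt0. Qed.

Lemma exe_block b s : (size b <= L)%N -> all straight b -> bounded X s ->
  exe X L (Block b) s (size b) (exec_block b s).
Proof.
move=> bL ab sX pre post /=.
(* Here [j] is the number of instructions already executed: the bound has then been squared [j]
   times, and [j + size c <= L] keeps it below the final one. *)
suff main c : forall j u q, (j + size c <= L)%N -> all straight c -> bounded (X ^ 2 ^ j) u ->
    steps (q ++ c ++ post) (X ^ 2 ^ L) (size c)
      (conf (size q) u) (conf (size q + size c) (foldl exec1 u c)).
  by apply: (main _ 0%N) => //; rewrite expn0 expn1.
elim: c => {b s pre bL ab sX} [|i b IH] j s pre /=.
  rewrite addn0 => jL _ sX; rewrite addn0; apply: steps0.
  by apply/bounded_words/(bounded_leq _ sX); rewrite leq_exp2l // leq_exp2l.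
move=> jL /andP[si ab] sX.
have onthi : onth (pre ++ i :: b ++ post) (size pre) = Some i.
  by rewrite onth_cat ltnn subnn.
have X1' : (1 < X ^ 2 ^ j)%N by rewrite (leq_trans X1) // -[leqLHS]expn1 leq_exp2l // expn_gt0.
have sX' := bounded_exec1 X1' si sX.
rewrite -expnM -expnSr in sX'.
rewrite -[X in steps _ _ X]add1n; apply: (@steps_trans _ _ _ _ _ (conf (size pre).+1 (exec1 s i))).
  rewrite -(step_conf s onthi) //; apply: steps1.
    by apply/bounded_words/(bounded_leq _ sX); rewrite leq_exp2l // leq_exp2l //; lia.
  rewrite (step_conf s onthi) //; apply/bounded_words/(bounded_leq _ sX').
  by rewrite leq_exp2l // leq_exp2l //; lia.
have jL' : (j.+1 + size b <= L)%N by rewrite addSnnS.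
by have := IH j.+1 (exec1 s i) (rcons pre i) jL' ab sX'; rewrite size_rcons cat_rcons addSnnS.
Qed.

Lemma exe_seq c1 c2 s1 s2 s3 t1 t2 : exe X L c1 s1 t1 s2 ->
  exe X L c2 s2 t2 s3 -> exe X L (Seq c1 c2) s1 (t1 + t2) s3.
Proof.
move=> e1 e2 pre post /=.
have := e1 pre (compile (size pre + size (compile (size pre) c1)) c2 ++ post).
have := e2 (pre ++ compile (size pre) c1) post.
rewrite size_cat -!catA => h2 h1; rewrite [size (_ ++ _)]size_cat addnA.
by apply: (steps_trans h1); move: h2; rewrite /= -catA.
Qed.

(** Leaving a loop costs two steps: the failed test falls through to the unconditional jump behind
    the loop. *)
Lemma exe_while_false r r' c s : bounded X s -> ~~ guard r r' s ->
  exe X L (While r r' c) s 2 s.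
Proof.
move=> sX gs pre post /=; set p := compile _ c; set q := pre ++ _.
have bw k := bounded_words k (bounded_leq Y1 sX).
have s1 : step q (conf (size pre) s) = conf (size pre).+1 s.
  rewrite (@step_jump _ _ r r' (size pre).+2) ?(negPf gs) //.
  by rewrite -[X in onth _ X]addn0 onth_size_cat.
have s2 : step q (conf (size pre).+1 s) = conf (size pre + size p + 3) s.
  rewrite (@step_jump _ _ 0 0 (size pre + size p + 3)) /guard ?lexx //.
  by rewrite -[X in onth _ X]addn1 onth_size_cat.
rewrite size_rcons -[2%N]/(1 + 1)%N; apply: (@steps_trans _ _ _ _ _ (conf (size pre).+1 s)).
  by rewrite -s1; apply: steps1 => //; rewrite s1.
have -> : (size pre + (size p).+3 = size pre + size p + 3)%N by lia.
by rewrite -s2; apply: steps1 => //; rewrite s2.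
Qed.

Lemma exe_while_true r r' c s1 s2 s3 t1 t2 : bounded X s1 -> bounded X s2 ->
  guard r r' s1 -> exe X L c s1 t1 s2 -> exe X L (While r r' c) s2 t2 s3 ->
  exe X L (While r r' c) s1 (t1 + 2 + t2) s3.
Proof.
move=> s1X s2X gs e1 e2 pre post.
apply: steps_trans (e2 pre post) => /=; set p := compile _ c; set q := pre ++ _.
have bw1 k := bounded_words k (bounded_leq Y1 s1X).
have bw2 k := bounded_words k (bounded_leq Y1 s2X).
have st1 : step q (conf (size pre) s1) = conf (size pre).+2 s1.
  rewrite (@step_jump _ _ r r' (size pre).+2) ?gs //.
  by rewrite -[X in onth _ X]addn0 onth_size_cat.
have st2 : step q (conf ((size pre).+2 + size p) s2) = conf (size pre) s2.
  rewrite (@step_jump _ _ 0 0 (size pre)) /guard ?lexx //.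
  have -> : ((size pre).+2 + size p = size pre + (size p).+2)%N by lia.
  by rewrite onth_size_cat /= -cats1 -catA -[X in onth _ X]addn0 onth_size_cat.
have := e1 (pre ++ [:: JumpLe r r' (size pre).+2; JumpLe 0 0 (size pre + size p + 3)])
  (JumpLe 0 0 (size pre) :: post).
rewrite size_cat /= addn2 -/p.
have -> : (pre ++ [:: JumpLe r r' (size pre).+2; JumpLe 0 0 (size pre + size p + 3)]) ++
   p ++ JumpLe 0 0 (size pre) :: post = q.
  by rewrite /q /= -cats1 -!catA.
move=> h; have -> : (t1 + 2 = 1 + t1 + 1)%N by lia.
have h1 : steps q (X ^ 2 ^ L) 1 (conf (size pre) s1) (conf (size pre).+2 s1).
  by rewrite -st1; apply: steps1 => //; rewrite st1.
have h2 : steps q (X ^ 2 ^ L) 1 (conf ((size pre).+2 + size p) s2) (conf (size pre) s2).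
  by rewrite -st2; apply: steps1 => //; rewrite st2.
exact: steps_trans (steps_trans h1 h) h2.
Qed.

(* [phi] is a time potential: each iteration, with its two jumps, is paid for by
   its decrease. *)
Lemma exe_while (Inv : nat -> state -> Prop) r r' c :
    (forall phi s, Inv phi s -> bounded X s) ->
    (forall phi s, Inv phi s -> guard r r' s ->
      exists t s' phi', [/\ exe X L c s t s', Inv phi' s' & (t + 2 + phi' <= phi)%N]) ->
  forall phi s, Inv phi s ->
    exists t s' phi', [/\ exe X L (While r r' c) s t s', Inv phi' s',
      ~~ guard r r' s' & (t + phi' <= phi + 2)%N].
Proof.
(* Strong induction on the potential, which drops by at least 2 in every iteration. *)
move=> IB IS phi; have [n] := ubnP phi; elim: n phi => // n IH phi phin s Is.
have sX := IB _ _ Is.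
have [gs|gs] := boolP (guard r r' s); last first.
  by exists 2, s, phi; split; [exact: exe_while_false| | |rewrite addnC].
have [t1 [s1 [phi1 [e1 I1 tphi]]]] := IS _ _ Is gs.
have [|t2 [s2 [phi2 [e2 I2 g2 tphi2]]]] := IH phi1 _ s1 I1; first by lia.
exists (t1 + 2 + t2)%N, s2, phi2; split=> //; last by lia.
exact: exe_while_true sX (IB _ _ I1) gs e1 e2.
Qed.

End Exe.

Lemma halted_iter p c t t' : halted p (iter t (step p) c) -> (t <= t')%N ->
  iter t' (step p) c = iter t (step p) c.
Proof.
move=> ht tt'; rewrite -(subnK tt') iterD; elim: (_ - _)%N => //= k ->.
by rewrite /step onth_default.
Qed.

(** The empty register list stands for registers that are all 0. As long as [L] is chosen
    independently of the input, the power [2 ^ L] keeps the word bound polynomial. *)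
Lemma exe_computes (X L : nat) (c : com) (w : seq int) (d t T : nat) (s : state) (N : nat) :
  exe X L c ([::], memory (initial w)) t s -> (t <= T)%N ->
  (X <= (\max_(x <- w) `|x|%N + 2) ^ d)%N -> outputs (conf (size (compile 0 c)) s) N ->
  computes_within (compile 0 c) (d * 2 ^ L) T w N.
Proof.
move=> /(_ [::] [::]); rewrite /= add0n cats0 => -[st bd] tT Xd out.
set p := compile 0 c in st bd out *.
have ini : initial w = conf 0 ([::], memory (initial w)).
  by rewrite /initial /conf /=; congr Config; apply/funext => x; rewrite nth_nil.
have hT k : (t <= k)%N -> iter k (step p) (initial w) = conf (size p) s.
  by move=> tk; rewrite -st ini; apply: halted_iter => //; rewrite st /halted /=.
have Yd : (X ^ 2 ^ L <= (\max_(x <- w) `|x|%N + 2) ^ (d * 2 ^ L))%N.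
  by rewrite expnM leq_exp2r // expn_gt0.
split; [by rewrite hT // /halted /=|by rewrite hT|].
move=> k.
have [wr wm] : words_bounded (X ^ 2 ^ L) (iter k (step p) (initial w)).
  have [kt|tk] := leqP k t; first by rewrite ini; exact: bd.
  by rewrite hT ?(ltnW tk) // -st; exact: bd.
by split=> [r|a]; [apply: leq_trans (wr r) Yd|apply: leq_trans (wm a) Yd].
Qed.

(** * Matchings of slots and cells *)

Section Matchings.
Local Open Scope fset_scope.
Variables (S C : choiceType) (nbs : C -> seq S) (ends : S -> seq C).
Hypothesis nbs_ends : forall s c, (s \in nbs c) = (c \in ends s).
Hypothesis nbs_uniq : forall c, uniq (nbs c).
Hypothesis ends_uniq : forall s, uniq (ends s).
Hypothesis size_ends : forall s, size (ends s) = 2%N.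

Implicit Types (A : {fset S}) (F : {fset C}) (M : {fset S * C}) (s : S) (c : C).

Definition degree A c := count [in A] (nbs c).

(** The graph of a bijection from [A] to [F] inside the incidence relation: the ends chosen for the
    edges. *)
Definition matching A F M : Prop :=
  [/\ forall s c, (s, c) \in M -> [/\ s \in A, c \in F & s \in nbs c],
      forall s, s \in A -> exists c, (s, c) \in M,
      forall c, c \in F -> exists s, (s, c) \in M,
      forall s c c', (s, c) \in M -> (s, c') \in M -> c = c'
    & forall s s' c, (s, c) \in M -> (s', c) \in M -> s = s'].

Definition matchings A F := [fset M in fpowerset (A `*` F) | `[< matching A F M >]].

Definition num_matchings A F := #|` matchings A F|.

Lemma in_matchings A F M : M \in matchings A F <-> matching A F M.
Proof.
rewrite !inE /=; split=> [/andP[_ /asboolP]//|MM]; apply/andP; split; last exact/asboolP.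
rewrite fpowersetE; apply/fsubsetP => -[s c] /(let: And5 h _ _ _ _ := MM in h)[sA cF _].
by rewrite !inE sA cF.
Qed.

Lemma num_matchings0 : num_matchings fset0 fset0 = 1%N.
Proof.
rewrite /num_matchings (_ : matchings _ _ = [fset fset0]) ?cardfs1 //.
apply/fsetP => M; rewrite inE; apply/idP/eqP => [/in_matchings[h _ _ _ _]|->].
  by apply/eqP/fset0Pn => -[[s c] /h[]]; rewrite inE.
by apply/in_matchings; split=> // ? ?; rewrite ?inE.
Qed.

Lemma degree0_num_matchings A F c : c \in F -> degree A c = 0%N -> num_matchings A F = 0%N.
Proof.
move=> cF /eqP; rewrite -leqn0 leqNgt -has_count => /hasPn hA.
apply/eqP; rewrite cardfs_eq0; apply/eqP/fsetP => M; rewrite inE; apply/negP.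
move=> /in_matchings[h _ /(_ c cF)[s sM] _ _].
by have [sA _ /hA/=] := h _ _ sM; rewrite sA.
Qed.

Definition matchings_with A F s c := [fset M in matchings A F | (s, c) \in M].

Lemma in_matchings_with A F s c M :
  M \in matchings_with A F s c <-> matching A F M /\ (s, c) \in M.
Proof.
rewrite !inE /=; split=> [/andP[/andP[_ /asboolP MM] sM]//|[MM sM]].
by have /in_matchings := MM; rewrite !inE /= sM => ->.
Qed.

(** Deleting the pair [(s, c)] is a bijection, whose inverse adds it back. *)
Lemma card_matchings_with A F s c : s \in A -> c \in F -> s \in nbs c ->
  #|` matchings_with A F s c| = num_matchings (A `\ s) (F `\ c).
Proof.
move=> sA cF sc; have inj : {in matchings_with A F s c &, injective (fun M => M `\ (s, c))}.
  move=> M M' /in_matchings_with[_ sM] /in_matchings_with[_ sM'] eqM.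
  by rewrite -(fsetD1K sM) eqM fsetD1K.
rewrite -(card_in_imfset imfset_key inj) /num_matchings; congr #|` _|.
apply/fsetP => M; apply/imfsetP/idP => /= [[M' + ->]|/in_matchings[h1 h2 h3 h4 h5]].
  move=> /in_matchings_with[[h1 h2 h3 h4 h5] sM].
  apply/in_matchings; split.
  - move=> s' c'; rewrite !inE => /andP[ne /[dup] /h1[-> -> ->] sM']; rewrite !andbT; split=> //.
      by apply: contra ne => /eqP e; rewrite e in sM' *; rewrite (h4 _ _ _ sM sM').
    by apply: contra ne => /eqP e; rewrite e in sM' *; rewrite (h5 _ _ _ sM sM').
  - move=> s'; rewrite !inE => /andP[ne /h2[c' sM']]; exists c'; rewrite !inE sM' andbT.
    by apply: contra ne => /eqP[->].
  - move=> c'; rewrite !inE => /andP[ne /h3[s' sM']]; exists s'; rewrite !inE sM' andbT.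
    by apply: contra ne => /eqP[_ ->].
  - by move=> s' c1 c2; rewrite !inE => /andP[_ /h4 h] /andP[_ /h].
  - by move=> s' c1 c2; rewrite !inE => /andP[_ /h5 h] /andP[_ /h].
have scM : (s, c) \notin M by apply/negP => /h1[]; rewrite !inE eqxx.
exists ((s, c) |` M); last by rewrite fsetU1K.
apply/in_matchings_with; split; last by rewrite in_fset1U eqxx.
split.
- move=> s' c'; rewrite !inE => /orP[/eqP[-> ->]//|/h1[]]; rewrite !inE.
  by case/andP=> _ -> /andP[_ ->].
- move=> s' s'A; have [->|ne] := eqVneq s' s; first by exists c; rewrite !inE eqxx.
  by have [|c' sM] := h2 s'; [rewrite !inE ne|exists c'; rewrite !inE sM orbT].
- move=> c' c'F; have [->|ne] := eqVneq c' c; first by exists s; rewrite !inE eqxx.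
  by have [|s' sM] := h3 c'; [rewrite !inE ne|exists s'; rewrite !inE sM orbT].
- move=> s' c1 c2; rewrite !inE => /orP[/eqP[-> ->]|m1] /orP[/eqP|m2].
  + by case.
  + by have [] := h1 _ _ m2; rewrite !inE eqxx.
  + by case=> e _; have [] := h1 _ _ m1; rewrite e !inE eqxx.
  + exact: h4 m1 m2.
- move=> s1 s2 c'; rewrite !inE => /orP[/eqP[-> ->]|m1] /orP[/eqP|m2].
  + by case.
  + by have [_] := h1 _ _ m2; rewrite !inE eqxx.
  + by case=> _ e; have [_] := h1 _ _ m1; rewrite e !inE eqxx.
  + exact: h5 m1 m2.
Qed.

(** Every matching has to use the only slot of [A] at [c]. *)
Lemma degree1_num_matchings A F s c : s \in A -> c \in F -> s \in nbs c ->
  degree A c = 1%N -> num_matchings A F = num_matchings (A `\ s) (F `\ c).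
Proof.
move=> sA cF sc deg1; rewrite -card_matchings_with //; congr #|` _|.
apply/fsetP => M; apply/idP/idP => [/in_matchings m|/in_matchings_with[m _]];
  last exact/in_matchings.
have [h1 _ h3 _ _] := m; have [s' s'M] := h3 _ cF; have [s'A _ s'c] := h1 _ _ s'M.
apply/in_matchings_with; split=> //; suff <- : s' = s by [].
move: deg1; rewrite /degree -size_filter => deg1.
have : s \in [seq x <- nbs c | x \in A] by rewrite mem_filter /= sA.
have : s' \in [seq x <- nbs c | x \in A] by rewrite mem_filter /= s'A.
by case: seq.filter deg1 => [|a [|b l]] //= _; rewrite !inE => /eqP -> /eqP ->.
Qed.

(** Both sides count the incident pairs: the inner counts are written as sums of indicators, and the
    two summations are exchanged. *)
Lemma sum_degree A F :
  \sum_(c <- F) degree A c = \sum_(s <- A) count [in F] (ends s) :> nat.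
Proof.
have count_sum (T : choiceType) (B : {fset T}) l : uniq l ->
    (count [in B] l = \sum_(b <- B) (b \in l))%N.
  move=> ul; rewrite -size_filter -sum1_size big_filter.
  rewrite -[RHS](big_mkcond [in l] (fun=> 1%N)).
  rewrite -big_filter -[RHS]big_filter; apply: perm_big; apply: uniq_perm.
  - exact: filter_uniq.
  - exact/filter_uniq/fset_uniq.
  - by move=> x; rewrite !mem_filter andbC.
under eq_bigr do rewrite /degree count_sum //.
rewrite exchange_big /=; apply: eq_bigr => s _; rewrite count_sum //.
by apply: eq_bigr => c _; rewrite nbs_ends.
Qed.

Lemma count_ends_le F s : (count [in F] (ends s) <= 2)%N.
Proof. by rewrite -(size_ends s) count_size. Qed.

(* Double counting: the average degree of a cell is at most 2. *)
Lemma all_degree2 A F : #|` A| = #|` F| -> (forall c, c \in F -> 1 < degree A c)%N ->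
  (forall c, c \in F -> degree A c = 2%N) /\ (forall s, s \in A -> {subset ends s <= F}).
Proof.
(* Terms that are all at least [k] have a sum of at least [k] times their number, and equality
   forces each of them to be [k]. *)
move=> AF deg2; have sF (g : C -> nat) k : (forall c, c \in F -> k <= g c)%N ->
    (k * #|` F| <= \sum_(c <- F) g c)%N /\
    (\sum_(c <- F) g c <= k * #|` F| -> forall c, c \in F -> g c <= k)%N.
  move=> gk; have e : (\sum_(c <- F) g c = k * #|` F| + \sum_(c <- F) (g c - k))%N.
    rewrite mulnC -sum1_size big_distrl /= -big_split /= !big_seq.
    by apply: eq_bigr => c /gk /subnKC; rewrite mul1n.
  split; first by rewrite e leq_addr.
  rewrite e => le c cF; have : (\sum_(c <- F) (g c - k) <= 0)%N by lia.
  by rewrite leqn0 (big_fsetD1 c cF) /= addn_eq0 => /andP[/eqP]; lia.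
have [l1 l2] := sF (degree A) 2%N deg2.
have := sum_degree A F; set X := \sum_(s <- A) _ => e.
(* The sum of the degrees falls short of twice the number of slots by the number of ends outside
   [F]. As there are as many slots as cells, this defect is 0 and so is the excess of the degrees
   over 2. *)
have XA : (X + \sum_(s <- A) (2 - count [in F] (ends s)) = 2 * #|` A|)%N.
  rewrite /X -big_split /= mulnC -sum1_size big_distrl /=.
  by apply: eq_bigr => s _; have := count_ends_le F s; rewrite mul1n; lia.
split=> [c cF|s sA].
  by apply/eqP; rewrite eqn_leq deg2 // l2 // e; lia.
rewrite e -AF in l1; have : (\sum_(s <- A) (2 - count [in F] (ends s)) <= 0)%N.
  by rewrite -(leq_add2l X) XA addn0.
rewrite leqn0 (big_fsetD1 s sA) /= addn_eq0 => /andP[/eqP c2 _] c cs.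
have /allP : all [in F] (ends s) by rewrite all_count size_ends eqn_leq count_ends_le //; lia.
by apply.
Qed.

Lemma size2_other (T : eqType) (l : seq T) x : uniq l -> size l = 2%N -> x \in l ->
  exists y, [/\ y \in l, x != y & forall z, z \in l -> z = x \/ z = y].
Proof.
case: l => [|a [|b [|]]] //=; rewrite inE andbT => ab _; rewrite !inE.
case/orP => /eqP ->; [exists b|exists a]; split;
  rewrite ?inE ?eqxx ?orbT // 1?eq_sym // => z; rewrite !inE => /orP[]/eqP; auto.
Qed.

(* When all degrees are 2, the complement of a matching in the adjacency
   relation is a matching: it shifts every cycle by one. *)
Lemma degree2_num_matchings A F s c : #|` A| = #|` F| ->
  (forall d, d \in F -> degree A d != 1%N) ->
  s \in A -> c \in F -> s \in nbs c -> degree A c = 2%N ->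
  num_matchings A F = (2 * num_matchings (A `\ s) (F `\ c))%N.
Proof.
move=> AF deg1 sA cF sc degc.
(* An isolated cell makes both sides 0: it differs from [c] and stays isolated after the
   deletion. *)
have [/existsP[[d dF] /= /eqP degd]|] := boolP [exists d : F, degree A (val d) == 0%N].
  rewrite (degree0_num_matchings dF degd) (@degree0_num_matchings _ _ d) ?muln0 //.
    by rewrite !inE dF andbT; apply/eqP => e; rewrite -e degd in degc.
  apply/eqP; rewrite -leqn0 -degd; apply: sub_count => x /=; rewrite !inE.
  by case/andP.
rewrite negb_exists => /forallP deg0.
have [|deg2 endsF] := @all_degree2 A F AF.
  by move=> d dF; have := deg0 [` dF]; have := deg1 _ dF; rewrite /=; lia.
pose E := [fset x in A `*` F | x.1 \in nbs x.2].
have inE' s' c' : ((s', c') \in E) = [&& s' \in A, c' \in F & s' \in nbs c'].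
  by rewrite !inE /= andbA.
have nb2 s' c' : s' \in A -> c' \in F -> s' \in nbs c' -> exists t,
    [/\ t \in A, t \in nbs c', s' != t & forall z, z \in A -> z \in nbs c' -> z = s' \/ z = t].
  move=> s'A c'F s'c'; have [|||t []] := @size2_other _ [seq x <- nbs c' | x \in A] s'.
  - exact: filter_uniq.
  - by rewrite size_filter; exact: deg2.
  - by rewrite mem_filter /= s'A.
  rewrite mem_filter => /andP[tA tc] st ht; exists t; split=> // z zA zc.
  by apply: ht; rewrite mem_filter /= zA.
(* A matching uses one of the two slots of each cell and one of the two ends of each slot; its
   complement in [E] uses the other one. *)
have compl M : matching A F M -> matching A F (E `\` M).
  move=> [h1 h2 h3 h4 h5]; split.
  - by move=> s' c'; rewrite in_fsetD inE' => /andP[_ /and3P[]].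
  - move=> s' s'A; have [c' m] := h2 _ s'A; have [_ c'F s'c'] := h1 _ _ m.
    have [||d [ds cd _]] := @size2_other _ (ends s') c' _ (size_ends s') => //.
      by rewrite -nbs_ends.
    exists d; rewrite in_fsetD inE' s'A nbs_ends ds (endsF _ s'A) // !andbT.
    by apply: contra cd => m'; rewrite (h4 _ _ _ m m').
  - move=> c' c'F; have [s' m] := h3 _ c'F; have [s'A _ s'c'] := h1 _ _ m.
    have [t [tA tc st _]] := nb2 _ _ s'A c'F s'c'.
    exists t; rewrite in_fsetD inE' tA tc c'F !andbT.
    by apply: contra st => m'; rewrite (h5 _ _ _ m m').
  - move=> s' c1 c2; rewrite !in_fsetD !inE' => /andP[n1 /and3P[s'A _ s1]] /andP[n2 /and3P[_ _ s2]].
    have [d m] := h2 _ s'A; have [_ dF sd] := h1 _ _ m.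
    have [||e [_ _ he]] := @size2_other _ (ends s') d _ (size_ends s') => //.
      by rewrite -nbs_ends.
    have d1 : c1 <> d by move=> e1; rewrite e1 m in n1.
    have d2 : c2 <> d by move=> e1; rewrite e1 m in n2.
    have [|/d1//|->] := he c1; first by rewrite -nbs_ends.
    by have [|/d2//|->] := he c2; first by rewrite -nbs_ends.
  - move=> s1 s2 c'; rewrite !in_fsetD !inE' => /andP[n1 /and3P[A1 c'F s1']] /andP[n2 /and3P[A2 _ s2']].
    have [d m] := h3 _ c'F; have [dA _ dc] := h1 _ _ m.
    have [e [_ _ _ he]] := nb2 _ _ dA c'F dc.
    have d1 : s1 <> d by move=> e1; rewrite e1 m in n1.
    have d2 : s2 <> d by move=> e1; rewrite e1 m in n2.
    by have [//|->] := he s1 A1 s1'; have [//|->] := he s2 A2 s2'.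
have subE M : matching A F M -> M `<=` E.
  by case=> h1 _ _ _ _; apply/fsubsetP => -[s' c'] /h1[? ? ?]; rewrite inE'; apply/and3P.
have complK M : matching A F M -> E `\` (E `\` M) = M.
  by move=> /subE ME; rewrite fsetDK.
have [t [tA tc st ht]] := nb2 _ _ sA cF sc.
rewrite -card_matchings_with // mul2n -addnn.
(* A matching gives [c] to one of its two slots [s] and [t]. Complementation in [E] exchanges these
   two classes, so they have the same size. *)
have -> : num_matchings A F =
    (#|` matchings_with A F s c| + #|` matchings_with A F t c|)%N.
  rewrite -cardfsUI (_ : _ `&` _ = fset0) ?cardfs0 ?addn0.
    congr #|` _|; apply/fsetP => M; apply/idP/idP => [/in_matchings m|]; last first.
      by case/fsetUP => /in_matchings_with[m _]; exact/in_matchings.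
    have [h1 _ h3 _ _] := m; have [s' x] := h3 _ cF; have [s'A _ s'c] := h1 _ _ x.
    apply/fsetUP; case: (ht _ s'A s'c) => e; rewrite e in x; [left|right];
      exact/in_matchings_with.
  apply/eqP; rewrite -fsubset0; apply/fsubsetP => M.
  case/fsetIP => /in_matchings_with[[_ _ _ _ h5] x] /in_matchings_with[_ x'].
  by move/eqP: st; case; exact: h5 x x'.
congr (_ + _)%N.
have inj : {in matchings_with A F s c &, injective (fun M => E `\` M)}.
  move=> M M' /in_matchings_with[m _] /in_matchings_with[m' _] e.
  by rewrite -(complK _ m) e complK.
rewrite -(card_in_imfset imfset_key inj); congr #|` _|; apply/fsetP => M.
have tE : (t, c) \in E by rewrite inE' tA cF.
have sE : (s, c) \in E by rewrite inE' sA cF.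
have shift x y N : (y, c) \in E -> x != y -> matching A F N -> (x, c) \in N ->
    E `\` N \in matchings_with A F y c.
  move=> yE xy m xN; apply/in_matchings_with; split; first exact: compl.
  rewrite in_fsetD yE andbT; apply: contra xy => yN.
  by case: m => _ _ _ _ /(_ _ _ _ xN yN) ->.
apply/idP/imfsetP => /= [/in_matchings_with[m x]|[M' /in_matchings_with[m x] ->]].
  by exists (E `\` M); [apply: shift sE _ m x; rewrite eq_sym|rewrite complK].
exact: shift tE st m x.
Qed.

(** If no cell were isolated, all degrees would be at least 2, hence equal to 2 by [all_degree2]. *)
Lemma num_matchings_eq0 A F c : #|` A| = #|` F| -> (forall d, d \in F -> degree A d != 1%N) ->
  c \in F -> degree A c != 2%N -> num_matchings A F = 0%N.
Proof.
move=> AF deg1 cF degc.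
have [/existsP[[d dF] /= /eqP degd]|] := boolP [exists d : F, degree A (val d) == 0%N].
  exact: degree0_num_matchings dF degd.
rewrite negb_exists => /forallP deg0.
have [|deg2 _] := @all_degree2 A F AF; last by rewrite deg2 // in degc.
by move=> d dF; have := deg0 [` dF]; have := deg1 _ dF; rewrite /=; lia.
Qed.

End Matchings.

(** * Covers as matchings *)

(* A slot [(true, p)] (resp. [(false, p)]) is the horizontal (resp. vertical) tip
   of the tromino with corner at the peg [p]. *)
Definition slot := (bool * cell)%type.

(** All potential slots are listed, whether or not there is a peg; intersecting with [slots P]
    selects the actual ones. The order is that of the lookups in [scan]. *)
Definition nbs (c : cell) : seq slot :=
  [:: (true, (c.1 + 1, c.2)); (true, (c.1 - 1, c.2));
      (false, (c.1, c.2 + 1)); (false, (c.1, c.2 - 1))].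

Definition ends (s : slot) : seq cell :=
  let p := s.2 in
  if s.1 then [:: (p.1 - 1, p.2); (p.1 + 1, p.2)]
  else [:: (p.1, p.2 - 1); (p.1, p.2 + 1)].

Lemma mem_nbs (s : slot) (c : cell) : (s \in nbs c) = (c \in ends s).
Proof.
case: s c => -[] [px py] [x y]; rewrite /nbs /ends !inE /= !xpair_eqE /=; lia.
Qed.

Lemma uniq_nbs c : uniq (nbs c).
Proof. by case: c => x y; rewrite /= !inE !xpair_eqE /=; lia. Qed.

Lemma uniq_ends s : uniq (ends s).
Proof. by case: s => -[] [x y]; rewrite /= !inE !xpair_eqE /=; lia. Qed.

Lemma size_ends s : size (ends s) = 2%N.
Proof. by case: s => -[]. Qed.

Section Covers.
Local Open Scope fset_scope.

Definition slots (P : {fset cell}) : {fset slot} :=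
  [fset (true, p) | p in P] `|` [fset (false, p) | p in P].

Lemma in_slots P b p : ((b, p) \in slots P) = (p \in P).
Proof.
rewrite in_fsetU; apply/orP/idP => [[] /imfsetP[q /= qP [_ ->]] //|pP].
by case: b; [left|right]; apply/imfsetP; exists p.
Qed.

Lemma card_slots P : #|` slots P| = (2 * #|` P|)%N.
Proof.
rewrite cardfsU (_ : _ `&` _ = fset0) ?cardfs0 ?subn0.
  by rewrite !card_imfset /= ?mul2n ?addnn // => x y [].
apply/fsetP => -[b p]; rewrite in_fsetI in_fset0; apply/negP.
by case/andP => /imfsetP[q _ [-> _]] /imfsetP[r _ []].
Qed.

Definition tip (b : bool) (t : tromino) : cell := if b then htip t else vtip t.

Lemma is_tromino_nbs t :
  is_tromino t = [forall b, (b, corner t) \in nbs (tip b t)].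
Proof.
have -> : [forall b, (b, corner t) \in nbs (tip b t)] =
    ((true, corner t) \in nbs (tip true t)) && ((false, corner t) \in nbs (tip false t)).
  apply/forallP/andP => [h|[h1 h2] []//]; split; exact: h.
case: t => [[[cx cy] [hx hy]] [vx vy]].
by rewrite /is_tromino /adjacent_cells /nbs /tip /corner /htip /vtip !inE /= !xpair_eqE /=; lia.
Qed.

Lemma in_tromino_cells c t : (c \in tromino_cells t) =
  (c == corner t) || [exists b, c == tip b t].
Proof.
rewrite !inE -orbA; congr (_ || _); apply/orP/existsP => [[]|[[]]] h; auto.
- by exists true.
- by exists false.
Qed.

Lemma tip_inj t b b' : is_tromino t -> tip b t = tip b' t -> b = b'.
Proof.
rewrite is_tromino_nbs => /forallP h; have := h true; have := h false.
case: t {h} => [[[cx cy] [hx hy]] [vx vy]]; rewrite /tip /corner /htip /vtip /= !inE !xpair_eqE /=.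
by case: b b' => -[] // h1 h2 []; lia.
Qed.

Lemma tip_in t b : tip b t \in tromino_cells t.
Proof. by rewrite in_tromino_cells; apply/orP; right; apply/existsP; exists b. Qed.

Lemma corner_in t : corner t \in tromino_cells t.
Proof. by rewrite in_tromino_cells eqxx. Qed.

Lemma tromino_eq t u : corner t = corner u -> (forall b, tip b t = tip b u) -> t = u.
Proof.
case: t u => [[c h] v] [[c' h'] v']; rewrite /corner /= => -> e.
by have /= := e true; have /= := e false; rewrite /tip /htip /vtip /= => -> ->.
Qed.

Variables S P : {fset cell}.
Hypothesis PS : P `<=` S.

Definition cover_of (M : {fset slot * cell}) : {fset tromino} :=
  [fset t in S `*` S `*` S | [forall b, ((b, corner t), tip b t) \in M]].

Lemma placeable_tip t b : p_placeable S P t ->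
  [/\ (b, corner t) \in slots P, tip b t \in S `\` P & (b, corner t) \in nbs (tip b t)].
Proof.
case; rewrite is_tromino_nbs => /forallP /(_ b) tb /fsubsetP sub cP hP vP.
split=> //; first by rewrite in_slots.
by rewrite in_fsetD (sub _ (tip_in t b)) andbT; case: b {tb}.
Qed.

Lemma cover_of_matching M : matching nbs (slots P) (S `\` P) M -> p_cover S P (cover_of M).
Proof.
move=> [h1 h2 h3 h4 h5].
have inC t : (t \in cover_of M) <-> forall b, ((b, corner t), tip b t) \in M.
  split=> [|h]; first by rewrite inE /= => /andP[_ /forallP].
  rewrite !inE /=; apply/andP; split; last exact/forallP.
  have [] := h1 _ _ (h true); have [] := h1 _ _ (h false).
  rewrite !in_slots !in_fsetD => cP /andP[_ vS] _ _ /andP[_ hS] _.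
  by rewrite hS vS (fsubsetP PS).
have pegslot p : p \in P -> exists2 t, t \in cover_of M & corner t = p.
  move=> pP; have [|h hM] := h2 (true, p); first by rewrite in_slots.
  have [|v vM] := h2 (false, p); first by rewrite in_slots.
  by exists (p, h, v) => //; apply/inC; case.
split.
- move=> t /inC h; split.
  + by rewrite is_tromino_nbs; apply/forallP => b; have [] := h1 _ _ (h b).
  + apply/fsubsetP => c; rewrite in_tromino_cells => /orP[/eqP ->|/existsP[b /eqP ->]].
      by have [+ _ _] := h1 _ _ (h true); rewrite in_slots; apply: (fsubsetP PS).
    by have [_ + _] := h1 _ _ (h b); rewrite in_fsetD => /andP[].
  + by have [+ _ _] := h1 _ _ (h true); rewrite in_slots.
  + by have [_ + _] := h1 _ _ (h true); rewrite in_fsetD => /andP[].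
  + by have [_ + _] := h1 _ _ (h false); rewrite in_fsetD => /andP[].
- move=> t u /inC ht /inC hu tu; apply/fdisjointP => c; apply: contraL => cu.
  apply: contra tu => ct; apply/eqP.
  (* Trominoes with the same corner agree, since a slot has only one cell. A common cell forces a
     common corner: a corner is a peg and a tip is not, and a common tip belongs to a single
     slot. *)
  suff ctu : corner t = corner u.
    by apply: tromino_eq => // b; apply: h4 (ht b) _; rewrite ctu.
  have tipP v b : (forall b, ((b, corner v), tip b v) \in M) -> tip b v \notin P.
    by move=> /(_ b) /h1[_ + _]; rewrite in_fsetD => /andP[].
  have corP v : (forall b, ((b, corner v), tip b v) \in M) -> corner v \in P.
    by move=> /(_ true) /h1[+ _ _]; rewrite in_slots.
  move: ct cu; rewrite !in_tromino_cells.
  case/orP => [/eqP ->|/existsP[b /eqP ->]]; case/orP => [/eqP //|].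
  + by case/existsP => b /eqP e; have := tipP _ b hu; rewrite -e corP.
  + by move=> e; have := tipP _ b ht; rewrite e corP.
  + by case/existsP => b' /eqP e; have := hu b'; rewrite -e => /(h5 _ _ _ (ht b)) [].
- move=> c cS; have [cP|cP] := boolP (c \in P).
    by have [t tC <-] := pegslot _ cP; exists t => //; exact: corner_in.
  have [|[b p] sM] := h3 c; first by rewrite in_fsetD cP.
  have [pP _ _] := h1 _ _ sM; rewrite in_slots in pP.
  have [t tC tp] := pegslot _ pP; exists t => //; rewrite -tp in sM.
  by move/inC: tC => /(_ b) /(h4 _ _ _ sM) ->; exact: tip_in.
Qed.

Lemma cover_of_inj M M' : matching nbs (slots P) (S `\` P) M ->
  matching nbs (slots P) (S `\` P) M' -> cover_of M = cover_of M' -> M = M'.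
Proof.
have sub A B : matching nbs (slots P) (S `\` P) A -> matching nbs (slots P) (S `\` P) B ->
    cover_of A = cover_of B -> A `<=` B.
  (* The two slots of the peg [p] yield a tromino of the common cover, and membership of that
     tromino in [cover_of B] gives the pair back. *)
  move=> [h1 h2 h3 h4 h5] _ e; apply/fsubsetP => -[[b p] c] m.
  have [+ _ _] := h1 _ _ m; rewrite in_slots => pP.
  have [|h hM] := h2 (true, p); first by rewrite in_slots.
  have [|v vM] := h2 (false, p); first by rewrite in_slots.
  have : (p, h, v) \in cover_of A.
    rewrite !inE /= (fsubsetP PS) //=; have [_ + _] := h1 _ _ hM; have [_ + _] := h1 _ _ vM.
    by rewrite !in_fsetD => /andP[_ ->] /andP[_ ->]; apply/forallP; case.
  rewrite e inE /= => /andP[_ /forallP /(_ b)]; rewrite /corner /=.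
  by case: b m => m; [rewrite (h4 _ _ _ m hM)|rewrite (h4 _ _ _ m vM)].
by move=> m m' e; apply/eqP; rewrite eqEfsubset !sub.
Qed.

Lemma cover_of_surj C : p_cover S P C ->
  exists2 M, matching nbs (slots P) (S `\` P) M & C = cover_of M.
Proof.
move=> [place disj cov].
have meet t u c : t \in C -> u \in C -> c \in tromino_cells t -> c \in tromino_cells u -> t = u.
  move=> tC uC ct cu; apply/eqP; apply: contraT => tu.
  by have /fdisjointP/(_ _ ct) := disj _ _ tC uC tu; rewrite cu.
pose M := [fset x in slots P `*` (S `\` P) |
  [exists t : C, (corner (val t) == x.1.2) && (tip x.1.1 (val t) == x.2)]].
have inM b p c : ((b, p), c) \in M <-> exists t, [/\ t \in C, corner t = p & tip b t = c].
  rewrite inE /=; split=> [/andP[_ /existsP[[t tC] /= /andP[/eqP ? /eqP ?]]]|[t [tC tp tc]]].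
    by exists t.
  have [sP cS _] := placeable_tip b (place _ tC).
  have pc : ((b, p), c) \in slots P `*` (S `\` P) by rewrite in_fsetM /= -tp -tc sP cS.
  by apply/andP; split=> //; apply/existsP; exists [` tC] => /=; rewrite tp tc !eqxx.
exists M.
  split.
  - move=> [b p] c /inM[t [tC <- <-]]; exact/placeable_tip/place.
  - move=> [b p]; rewrite in_slots => pP; have [t tC pt] := cov _ (fsubsetP PS _ pP).
    exists (tip b t); apply/inM; exists t; split=> //.
    (* A tromino that covers a peg has its corner there, because tips avoid the pegs. *)
    move: pt; rewrite in_tromino_cells => /orP[/eqP -> //|/existsP[b' /eqP e]].
    by have [_ + _] := placeable_tip b' (place _ tC); rewrite in_fsetD -e pP.
  - move=> c; rewrite in_fsetD => /andP[cP cS]; have [t tC ct] := cov _ cS.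
    move: ct; rewrite in_tromino_cells => /orP[/eqP e|/existsP[b /eqP e]].
      by have [+ _ _] := placeable_tip true (place _ tC); rewrite in_slots -e (negPf cP).
    by exists (b, corner t); apply/inM; exists t.
  - move=> [b p] c c' /inM[t [tC tp <-]] /inM[u [uC up <-]]; congr tip.
    by apply: (meet _ _ p tC uC); rewrite -?tp ?corner_in // tp -up corner_in.
  - move=> [b p] [b' p'] c /inM[t [tC tp tc]] /inM[u [uC up uc]].
    have tu : t = u by apply: (meet _ _ c tC uC); rewrite -?tc ?tip_in // tc -uc tip_in.
    rewrite -tp -up -tu; congr pair; apply: (@tip_inj t); last by rewrite tc -uc tu.
    by have [] := place _ tC.
apply/fsetP => t; apply/idP/idP => [tC|].
  have [_ /fsubsetP sub _ _ _] := place _ tC.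
  rewrite !inE /= (sub _ (corner_in t)) (sub _ (tip_in t true)) (sub _ (tip_in t false)) /=.
  by apply/forallP => b; apply/inM; exists t.
rewrite inE /= => /andP[_ /forallP h].
(* The two tips of [t] might come from different trominoes of [C]; these share their corner, so they
   coincide. *)
have /inM[u [uC uc ut]] := h true; have /inM[v [vC vc vt]] := h false.
suff -> : t = u by [].
have uv : v = u by apply: (meet _ _ (corner t) vC uC); rewrite -?uc ?corner_in // uc -vc corner_in.
by apply: tromino_eq => // -[] //; rewrite -vt uv.
Qed.

Lemma num_p_covers_matchings : num_p_covers S P = num_matchings nbs (slots P) (S `\` P).
Proof.
have inj : {in matchings nbs (slots P) (S `\` P) &, injective cover_of}.
  by move=> M M' /in_matchings m /in_matchings m'; exact: cover_of_inj.
rewrite /num_matchings -(card_in_imfset imfset_key inj); congr #|` _|.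
apply/fsetP => C; apply/idP/imfsetP => /= [|[M /in_matchings m ->]].
  rewrite inE /= => /andP[_ /asboolP /cover_of_surj[M m ->]].
  by exists M => //; exact/in_matchings.
rewrite inE /=; apply/andP; split; last exact/asboolP/cover_of_matching.
by rewrite fpowersetE; apply/fsubsetP => t; rewrite inE => /andP[].
Qed.

End Covers.

(** * The program *)

Section Program.
Local Open Scope nat_scope.

(* Registers: 0 and 1 hold 0 and 1; 2: twice the number of cells; 3: [K]; 4: [base K];
   5, 7, 9, 11: offsets from a cell to its four slots, each followed by the offset to
   the other end of the slot; 13: [3 * K]; 14: position in the input; 15: address of the
   current cell; 16-21: results of [scan]; 22, 23: highest degree at which the current
   scan starts, resp. continues, deleting (1 in the first scan, 2, resp. 1 after the
   first deletion, in the second); 24: number of cells left; 25: number of cycles; 26: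
   end of the input. *)

Definition load_cell : seq instr :=
  [:: Read 15 14; Mul 15 15 13; Add 15 15 4; Add 14 14 1; Read 20 14; Add 15 15 20;
      Add 14 14 1].

(** The table entry read is 0 or 1, so multiplying by it is a conditional assignment without a jump:
    if the slot is present, registers 18 and 19 receive its address and that of its other end.
    Register 17 accumulates the degree. *)
Definition look (e f : nat) : seq instr :=
  [:: Add 20 15 e; Read 16 20; Add 17 17 16;
      Defs.Sub 20 20 18; Mul 20 20 16; Add 18 18 20;
      Add 20 15 f; Defs.Sub 20 20 19; Mul 20 20 16; Add 19 19 20].

(* The last line puts [(d - 1) * (thr - d)] in register 21, where [d] is the degree of the
   current cell, or 0 if the cell is deleted: it is nonnegative iff [1 <= d <= thr]. *)
Definition scan : seq instr :=
  [:: Const 17 0; Const 18 0; Const 19 0] ++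
  look 5 6 ++ look 7 8 ++ look 9 10 ++ look 11 12 ++
  [:: Read 16 15; Mul 16 16 17; Defs.Sub 21 16 1; Defs.Sub 20 23 16; Mul 21 21 20].

(** Position 0 holds the number [n] of cells and the next [2n] words are their coordinates. The pegs
    need not be summed, being cells of the region. *)
Definition sum_squares : com :=
  While 14 2 (Block [:: Read 20 14; Mul 20 20 20; Add 3 3 20; Add 3 3 20; Add 14 14 1]).

(** Three doublings of [K * K] give [base K]. Register 14 is now at the word holding the number of
    pegs, from which the number of peg-free cells and the end of the input are derived. *)
Definition constants : com := Block
  [:: Mul 4 3 3; Add 4 4 4; Add 4 4 4; Add 4 4 4;
      Add 20 3 3; Add 13 20 3; Add 5 13 3; Add 6 13 13;
      Defs.Sub 7 0 20; Defs.Sub 8 0 6; Add 9 20 1; Const 10 2; Defs.Sub 11 20 1; Defs.Sub 12 0 10;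
      Read 20 14; Defs.Sub 24 24 20; Add 26 14 20; Add 26 26 20; Const 14 1].

Definition fill_cells : com := While 14 2 (Block (load_cell ++ [:: Write 15 1])).

(** A peg is not a vertex, so its mark as a cell is erased; its two slots lie at the distances [K]
    and [2K] from that mark. *)
Definition fill_pegs : com :=
  While 14 26 (Block (load_cell ++
    [:: Write 15 0; Add 15 15 3; Write 15 1; Add 15 15 3; Write 15 1])).

(** Adding the threshold minus 1 counts a cycle exactly when one is opened at degree 2. The chain
    goes on at the other end of the deleted slot with threshold 1. *)
Definition chain_kill : seq instr :=
  [:: Write 15 0; Write 18 0; Defs.Sub 24 24 1; Add 25 25 23; Defs.Sub 25 25 1; Add 15 19 0;
      Const 23 1].

Definition chain : com := While 0 21 (Block (chain_kill ++ scan)).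

Definition phase : com :=
  While 14 2 (Seq (Block (load_cell ++ Add 23 22 0 :: scan)) chain).

(* The first loop is a conditional: no matching exists if a cell is left. *)
Definition output : com :=
  Seq (Block [:: Add 20 25 1; Add 14 20 0; Write 20 1])
  (Seq (While 1 24 (Block [:: Add 14 0 0; Add 24 0 0]))
  (Seq (While 1 25 (Block [:: Write 25 0; Defs.Sub 25 25 1]))
       (Block [:: Write 0 14]))).

(** Writing register 26 first pads the register list to its full length. The initial value 9 of [K]
    is built as 4 + 4 + 1 because constants are at most 4. *)
Definition start : com :=
  Seq (Block [:: Const 26 0; Const 1 1; Read 24 0; Add 2 24 24; Const 3 4; Add 3 3 3; Add 3 3 1])
  (Seq sum_squares constants).

Definition counter : com :=
  Seq start
  (Seq fill_cells
  (Seq (Block [:: Add 14 14 1])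
  (Seq fill_pegs
  (Seq (Block [:: Const 14 1; Const 22 1])
  (Seq phase
  (Seq (Block [:: Const 14 1; Const 22 2])
  (Seq phase output))))))).

End Program.

(** * The direct-address table and its symbolic execution *)

Definition base (K : int) : int :=
  K * K + K * K + (K * K + K * K) + (K * K + K * K + (K * K + K * K)).

(* [K] exceeds twice the coordinates, so that cells (t = 0), horizontal slots (t = 1) and
   vertical slots (t = 2) have distinct addresses, all beyond the input. *)
Definition adr (K : int) (t : int) (c : cell) : int :=
  c.1 * (K + K + K) + base K + c.2 + t * K.

Definition tag (b : bool) : int := if b then 1 else 2.

(** The reflection of [c] in the peg of [s]. *)
Definition other (c : cell) (s : slot) : cell :=
  (s.2.1 + s.2.1 - c.1, s.2.2 + s.2.2 - c.2).

(** The constants are kept in the form in which the machine computes them, so that the effect of a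
    block holds by conversion. *)
Definition regs (K n2 i a x deg pe pf t g thr0 thr q k lim : int) : seq int :=
  [:: 0; 1; n2; K; base K; K + K + K + K; K + K + K + (K + K + K); 0 - (K + K);
      0 - (K + K + K + (K + K + K)); K + K + 1; 2; K + K - 1; 0 - 2; K + K + K;
      i; a; x; deg; pe; pf; t; g; thr0; thr; q; k; lim].

Lemma exec_block_cat b1 b2 s : exec_block (b1 ++ b2) s = exec_block b2 (exec_block b1 s).
Proof. exact: foldl_cat. Qed.

Lemma load_cellE K n2 i a x deg pe pf t g thr0 thr q k lim m :
  exec_block load_cell (regs K n2 i a x deg pe pf t g thr0 thr q k lim, m) =
  (regs K n2 (i + 1 + 1) (m i * (K + K + K) + base K + m (i + 1)) x deg pe pf (m (i + 1)) g
     thr0 thr q k lim, m).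
Proof. by []. Qed.

Lemma chain_killE K n2 i a x deg pe pf t g thr0 thr q k lim m :
  exec_block chain_kill (regs K n2 i a x deg pe pf t g thr0 thr q k lim, m) =
  (regs K n2 i (pf + 0) x deg pe pf t g thr0 1%N%:Z (q - 1) (k + thr - 1) lim,
   upd (upd m a 0) pe 0).
Proof. by []. Qed.

Lemma set_thrE K n2 i a x deg pe pf t g thr0 thr q k lim m :
  exec_block [:: Add 23 22 0] (regs K n2 i a x deg pe pf t g thr0 thr q k lim, m) =
  (regs K n2 i a x deg pe pf t g thr0 (thr0 + 0) q k lim, m).
Proof. by []. Qed.

Lemma lookE (e f : nat) (ve vf : int) K n2 i a x deg pe pf t g thr0 thr q k lim m :
  (e, f, ve, vf) \in [:: (5%N, 6%N, K + K + K + K, K + K + K + (K + K + K));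
     (7%N, 8%N, 0 - (K + K), 0 - (K + K + K + (K + K + K)));
     (9%N, 10%N, K + K + 1, 2); (11%N, 12%N, K + K - 1, 0 - 2)] ->
  exec_block (look e f) (regs K n2 i a x deg pe pf t g thr0 thr q k lim, m) =
  (let v := m (a + ve) in
   regs K n2 i a v (deg + v) (pe + (a + ve - pe) * v) (pf + (a + vf - pf) * v)
     ((a + vf - pf) * v) g thr0 thr q k lim, m).
Proof. by rewrite !inE => /or4P[] /eqP[-> -> -> ->]. Qed.

Section Layout.
Variable K : int.

Definition word_bound : nat := `|(100 * (K * K))%R|%N.

Lemma le_word_bound z : - (100 * (K * K)) <= z -> z <= 100 * (K * K) -> (`|z| <= word_bound)%N.
Proof. rewrite /word_bound; lia. Qed.

(** Addresses are injective on this range; [near] leaves a margin of one cell, so that the slots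
    looked up stay inside it. *)
Definition inr (c : cell) := (-K < c.1 + c.1 < K) && (-K < c.2 + c.2 < K).

Definition near (c : cell) :=
  (-K < c.1 + c.1 - 2) && (c.1 + c.1 + 2 < K) && (-K < c.2 + c.2 - 2) && (c.2 + c.2 + 2 < K).

Lemma near_inr c : near c -> inr c.
Proof. by rewrite /near /inr; lia. Qed.

Lemma near_nbs (c : cell) (s : slot) : near c -> s \in nbs c -> inr s.2.
Proof.
by case: c => x y; rewrite /near /inr !inE => h /or4P[] /eqP -> /=; move: h => /=; lia.
Qed.

Hypothesis K9 : 9 <= K.

Lemma word_bound_gt1 : (1 < word_bound)%N.
Proof. rewrite /word_bound; nia. Qed.

Lemma KK : 9 * K <= K * K. Proof. nia. Qed.

Lemma le_word_bound_small z : (`|z| <= `|(8 * K)%R|)%N -> (`|z| <= word_bound)%N.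
Proof. by move=> h; apply: le_word_bound; have := KK; lia. Qed.

Lemma le_word_bound_base : (`|base K| <= word_bound)%N.
Proof. by apply: le_word_bound; rewrite /base; have := KK; lia. Qed.

Lemma bounded_regs (n2 i a x deg pe pf t g thr0 thr q k lim' : int) m :
  (forall b, (`|m b| <= word_bound)%N) ->
  all (fun z : int => (`|z| <= word_bound)%N) [:: a; pe; pf] ->
  all (fun z : int => (`|z| <= `|(K + K)%R|)%N) [:: n2; i; x; deg; t; g; thr0; thr; q; k; lim'] ->
  bounded word_bound (regs K n2 i a x deg pe pf t g thr0 thr q k lim', m).
Proof.
move=> hm; rewrite /= !andbT => /and3P[ha hpe hpf] small; split=> //.
have X2 z : (`|z| <= `|(K + K)%R|)%N -> (`|z| <= word_bound)%N.
  by move=> h; apply/le_word_bound_small/(leq_trans h); move: K9; clear; lia.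
have hbase := le_word_bound_base.
move: small; rewrite /= !andbT ha hpe hpf hbase.
case/and5P=> /X2 -> /X2 -> /X2 -> /X2 -> /and5P[/X2 -> /X2 -> /X2 -> /X2 -> /and3P[/X2 -> /X2 -> /X2 ->]].
have K9' := K9; have XK := le_word_bound_small; clear -K9' XK.
by rewrite -[(0 + 1 - 0 < _)%N]/(`|(- 2)%R| <= word_bound)%N
  -[(1 + 1 <= _)%N]/(`|2%R| <= word_bound)%N
  -[(0 < _)%N]/(`|1%R| <= word_bound)%N !XK //; lia.
Qed.

(** The second coordinates differ by less than [K], so the coefficients [3x + t] and [3x' + t'] of
    [K] agree; as [t] and [t'] differ by at most 2, they are equal too. *)
Lemma adr_inj (t t' : int) (c c' : cell) : 0 <= t <= 2 -> 0 <= t' <= 2 -> inr c -> inr c' ->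
  adr K t c = adr K t' c' -> t = t' /\ c = c'.
Proof.
case: c c' => [x y] [x' y']; rewrite /inr /adr /= => ht ht' hc hc' e.
have : K * (x + x + x + t - (x' + x' + x' + t')) = y' - y.
  by apply/eqP; rewrite -subr_eq0; move/eqP: e; rewrite -subr_eq0 => /eqP <-; apply/eqP; ring.
have [u hu] : exists u, u = x + x + x + t - (x' + x' + x' + t') by eexists.
rewrite -hu => hK.
have K0 : 0 < K by lia.
have u1 : u < 1 by rewrite -(ltr_pM2l K0) hK; lia.
have u2 : -1 < u by rewrite -(ltr_pM2l K0) hK; lia.
have u0 : u = 0 by lia.
rewrite u0 mulr0 in hK; split; first by lia.
congr pair; lia.
Qed.

(** The lower bound separates the table from the input, whose last position [lim] is below
    [K + K]. *)
Lemma adr_bound (t : int) (c : cell) : 0 <= t <= 2 -> inr c -> K + K < adr K t c < 20 * (K * K).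
Proof.
case: c => x y; rewrite /inr /adr /base /= => ht hc.
have h1 : - (K * K) <= x * K + x * K <= K * K by nia.
have h2 : 0 <= t * K <= K + K by nia.
have := KK; lia.
Qed.

Lemma adr_loose (t : int) (c : cell) : 0 <= t <= 2 -> (-K < c.1 < K) && (-K < c.2 < K) ->
  (`|adr K t c| <= word_bound)%N.
Proof.
case: c => x y /= ht hc; rewrite /adr /base /=; have := KK.
have K0 : 0 <= K by lia.
have h1 : - (K * K) <= x * K <= K * K.
  by rewrite -mulNr; apply/andP; split; apply: ler_wpM2r => //; lia.
have h2 : 0 <= t * K <= 2 * K.
  by apply/andP; split; [apply: mulr_ge0|apply: ler_wpM2r] => //; lia.
by move=> h3; apply: le_word_bound; lia.
Qed.

Lemma zero_range : 0 <= (0 : int) <= 2. Proof. by []. Qed.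

Lemma adr_near (t : int) c : 0 <= t <= 2 -> near c -> (`|adr K t c| <= word_bound)%N.
Proof.
move=> ht hc; apply: (adr_loose ht).
by move: hc K9; rewrite /near; clear; lia.
Qed.

Variables (w : seq int) (n2 lim : nat).
Hypothesis limK : lim%:Z < K + K.

Definition in_layout (F : {fset cell}) (A : {fset slot}) (t : int) (c : cell) : bool :=
  if t == 0 then c \in F else (t == 1, c) \in A.

(** The input has to stay intact because both scans read the list of cells again. *)
Definition layout (f : int -> cell -> bool) (m : int -> int) : Prop :=
  [/\ forall j : nat, (j <= lim)%N -> m j%:Z = nth 0 w j,
      forall t c, 0 <= t <= 2 -> inr c -> m (adr K t c) = (f t c)%:Z
    & forall a, (`|m a| <= word_bound)%N].

Lemma layout_mem f m : layout f m -> forall a, (`|m a| <= word_bound)%N.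
Proof. by case. Qed.

Lemma layout_ext f g m : (forall t c, 0 <= t <= 2 -> f t c = g t c) ->
  layout f m -> layout g m.
Proof. by move=> fg [h1 h2 h3]; split=> // t c ht hc; rewrite h2 // fg. Qed.

(** By [adr_bound] the write misses the input, and by [adr_inj] it changes a single entry of the
    table. *)
Lemma layout_upd f m t c (v : bool) : 0 <= t <= 2 -> inr c -> layout f m ->
  layout (fun t' c' => if (t' == t) && (c' == c) then v else f t' c') (upd m (adr K t c) v%:Z).
Proof.
move=> ht hc [h1 h2 h3]; split.
- move=> j jl; rewrite /upd; case: eqP => [e|_]; last exact: h1.
  by have := adr_bound ht hc; rewrite -e; lia.
- move=> t' c' ht' hc'; rewrite /upd h2 //.
  have [e|ne] := eqVneq (adr K t' c') (adr K t c).
    by have [-> ->] := adr_inj ht' ht hc' hc e; rewrite !eqxx.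
  by case: andP => // -[/eqP et /eqP ec]; rewrite et ec eqxx in ne.
- by move=> a; rewrite /upd; case: eqP => // _; apply: le_word_bound; have := KK; case: v; lia.
Qed.

Local Open Scope fset_scope.
Local Open Scope ring_scope.

Lemma layout_del_cell F A m c : inr c -> layout (in_layout F A) m ->
  layout (in_layout (F `\ c) A) (upd m (adr K 0 c) 0).
Proof.
move=> hc h; have := @layout_upd _ _ 0 c false isT hc h; apply: layout_ext => t c' _.
by rewrite /in_layout in_fsetD1; case: (t == 0); case: (c' == c).
Qed.

Lemma layout_add_cell F A m c : inr c -> layout (in_layout F A) m ->
  layout (in_layout (c |` F) A) (upd m (adr K 0 c) 1).
Proof.
move=> hc h; have := @layout_upd _ _ 0 c true isT hc h; apply: layout_ext => t c' _.
by rewrite /in_layout in_fset1U; case: (t == 0); case: (c' == c).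
Qed.

Lemma tag_range b : 0 <= tag b <= 2. Proof. by case: b. Qed.

Lemma tag_eq t b : 0 <= t <= 2 -> t != 0 -> (t == tag b) = ((t == 1) == b).
Proof. rewrite /tag; case: b; lia. Qed.

Lemma layout_del_slot F A m b c : inr c -> layout (in_layout F A) m ->
  layout (in_layout F (A `\ (b, c))) (upd m (adr K (tag b) c) 0).
Proof.
move=> hc h; have := @layout_upd _ _ _ c false (tag_range b) hc h; apply: layout_ext => t c' ht.
rewrite /in_layout in_fsetD1 xpair_eqE; case: (eqVneq t 0) => [->|t0]; first by case: b.
by rewrite tag_eq //; case: (_ == b); case: (c' == c).
Qed.

Lemma layout_add_slot F A m b c : inr c -> layout (in_layout F A) m ->
  layout (in_layout F ((b, c) |` A)) (upd m (adr K (tag b) c) 1).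
Proof.
move=> hc h; have := @layout_upd _ _ _ c true (tag_range b) hc h; apply: layout_ext => t c' ht.
rewrite /in_layout in_fset1U xpair_eqE; case: (eqVneq t 0) => [->|t0]; first by case: b.
by rewrite tag_eq //; case: (_ == b); case: (c' == c).
Qed.

Lemma layout_cell F A m c : inr c -> layout (in_layout F A) m -> m (adr K 0 c) = (c \in F)%:Z.
Proof. by move=> hc [_ h _]; rewrite h. Qed.

Lemma layout_slot F A m b c : inr c -> layout (in_layout F A) m ->
  m (adr K (tag b) c) = ((b, c) \in A)%:Z.
Proof. by move=> hc [_ h _]; rewrite h ?tag_range //; case: b. Qed.

(** It does not matter which present slot is found: at degree 1 it is unique, and a cycle may be
    opened in either direction. *)
Definition looked (A : {fset slot}) (c : cell) (l : seq slot) (deg pe pf : int) : Prop :=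
  deg = (count [in A] l)%:Z /\
  (if (0 < count [in A] l)%N then exists s, [/\ s \in l, s \in A,
      pe = adr K (tag s.1) s.2 & pf = adr K 0 (other c s)]
   else pe = 0 /\ pf = 0).

Lemma looked_rcons A c l s deg pe pf (v e f : int) :
  looked A c l deg pe pf -> v = (s \in A)%:Z -> e = adr K (tag s.1) s.2 ->
  f = adr K 0 (other c s) ->
  looked A c (rcons l s) (deg + v) (pe + (e - pe) * v) (pf + (f - pf) * v).
Proof.
rewrite /looked -cats1 count_cat /= addn0 => -[-> h] -> -> ->.
rewrite -PoszD; split=> //; have [sA|sA] := boolP (s \in A).
  rewrite addn1 /=; exists s; rewrite mem_cat inE eqxx orbT; split=> //; ring.
rewrite addn0 !mulr0 !addr0; case: ifP h => // _ [s' [sl sA' -> ->]].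
by exists s'; rewrite mem_cat sl.
Qed.

(** The degree is multiplied by the membership bit, so that a deleted cell, whose slots may still be
    present, counts as degree 0 and fails the guard. *)
Lemma scanE F A m c i x deg pe pf t g thr0 thr q k lim' : near c ->
  layout (in_layout F A) m ->
  exists pe' pf', looked A c (nbs c) (degree nbs A c)%:Z pe' pf' /\
  let x' := (c \in F)%:Z * (degree nbs A c)%:Z in
  exec_block scan (regs K n2%:Z i (adr K 0 c) x deg pe pf t g thr0 thr q k lim', m) =
  (regs K n2%:Z i (adr K 0 c) x' (degree nbs A c)%:Z pe' pf' (thr - x')
     ((x' - 1) * (thr - x')) thr0 thr q k lim', m).
Proof.
move=> hc hm; rewrite /scan !exec_block_cat.
rewrite [exec_block [:: Const _ _; _; _] _](_ : _ =
  (regs K n2%:Z i (adr K 0 c) x 0 0 0 t g thr0 thr q k lim', m)) //.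
rewrite (@lookE 5%N 6%N (K + K + K + K) (K + K + K + (K + K + K))); last by rewrite !inE eqxx.
rewrite (@lookE 7%N 8%N (0 - (K + K)) (0 - (K + K + K + (K + K + K))));
  last by rewrite !inE eqxx orbT.
rewrite (@lookE 9%N 10%N (K + K + 1) 2); last by rewrite !inE eqxx !orbT.
rewrite (@lookE 11%N 12%N (K + K - 1) (0 - 2)); last by rewrite !inE eqxx !orbT.
cbv zeta; set a := adr K 0 c.
set s1 : slot := (true, (c.1 + 1, c.2)); set s2 : slot := (true, (c.1 - 1, c.2)).
set s3 : slot := (false, (c.1, c.2 + 1)); set s4 : slot := (false, (c.1, c.2 - 1)).
have e1 : a + (K + K + K + K) = adr K (tag s1.1) s1.2.
  by rewrite /a /adr /tag /=; ring.
have e2 : a + (0 - (K + K)) = adr K (tag s2.1) s2.2.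
  by rewrite /a /adr /tag /=; ring.
have e3 : a + (K + K + 1) = adr K (tag s3.1) s3.2.
  by rewrite /a /adr /tag /=; ring.
have e4 : a + (K + K - 1) = adr K (tag s4.1) s4.2.
  by rewrite /a /adr /tag /=; ring.
have mE s e : s \in nbs c -> a + e = adr K (tag s.1) s.2 -> m (a + e) = (s \in A)%:Z.
  by case: s => b p sc ->; rewrite (layout_slot _ (near_nbs hc sc) hm).
have f1 : a + (K + K + K + (K + K + K)) = adr K 0 (other c s1).
  by rewrite /a /adr /other /=; ring.
have f2 : a + (0 - (K + K + K + (K + K + K))) = adr K 0 (other c s2).
  by rewrite /a /adr /other /=; ring.
have f3 : a + 2 = adr K 0 (other c s3).
  by rewrite /a /adr /other /=; ring.
have f4 : a + (0 - 2) = adr K 0 (other c s4).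
  by rewrite /a /adr /other /=; ring.
have k0 : looked A c [::] 0 0 0 by [].
have n j : (j < 4)%N -> nth s1 [:: s1; s2; s3; s4] j \in nbs c by move=> ?; exact: mem_nth.
have k1 := looked_rcons k0 (mE s1 _ (n 0%N isT) e1) e1 f1.
have k2 := looked_rcons k1 (mE s2 _ (n 1%N isT) e2) e2 f2.
have k3 := looked_rcons k2 (mE s3 _ (n 2%N isT) e3) e3 f3.
have k4 := looked_rcons k3 (mE s4 _ (n 3%N isT) e4) e4 f4.
have [degE _] := k4; rewrite -[rcons _ _]/(nbs c) -/(degree nbs A c) in degE.
rewrite [in word_bound in looked _ _ _ word_bound]degE in k4.
eexists; eexists; split; first exact: k4.
rewrite degE -(layout_cell (near_inr hc) hm).
by [].
Qed.

End Layout.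

(** * The two scans *)

Lemma scan_small (K : int) (n j deg thr thr0 q k lim : nat) (b : bool) :
  n.*2%:Z + 9 <= K -> lim%:Z < K + K -> (j < n)%N -> (deg <= 4)%N -> (0 < thr <= 2)%N ->
  (thr0 <= 2)%N -> (q <= n)%N -> (k <= n)%N ->
  all (fun z : int => (`|z| <= `|(K + K)%R|)%N) [:: n.*2%:Z; j.*2.+3%:Z; b%:Z * deg%:Z; deg%:Z;
    thr%:Z - b%:Z * deg%:Z; (b%:Z * deg%:Z - 1) * (thr%:Z - b%:Z * deg%:Z); thr0%:Z; thr%:Z; q%:Z; k%:Z; lim%:Z].
Proof.
move=> nK limK jn hdeg hthr hthr0 qn kn.
have: 0 <= b%:Z * deg%:Z <= 4 by case: b; lia.
move: (b%:Z * deg%:Z) => x hx.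
have: -15 <= (x - 1) * (thr%:Z - x) <= 15 by case: thr hthr => [|[|[|]]] // _; nia.
move: (_ * _) => g hg; rewrite /= andbT.
by repeat (apply/andP; split); lia.
Qed.

Section Phases.
Variables (K : int) (s0 p0 : seq cell) (w : seq int) (L : nat).
Hypothesis K9 : 9 <= K.
Hypothesis L100 : (100 <= L)%N.
Local Open Scope fset_scope.
Local Open Scope ring_scope.

Let n := size s0.
Let lim := (n.*2 + 1 + (size p0).*2)%N.
Let F0 : {fset cell} := [fset c in s0 | c \notin p0].
Let A0 : {fset slot} := slots [fset p in p0].
Let N0 := num_matchings nbs A0 F0.

Hypothesis nK : n.*2%:Z + 9 <= K.
Hypothesis limK : lim%:Z < K + K.
(** The margin 6 is twice 2 + 1: the other end of a slot is two cells away and must itself be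
    [near]. *)
Hypothesis central : forall c : cell, c \in s0 -> (-K < c.1 + c.1 - 6) && (c.1 + c.1 + 6 < K) &&
  (-K < c.2 + c.2 - 6) && (c.2 + c.2 + 6 < K).
Hypothesis s0w : forall j, (j < n)%N -> nth 0 w j.*2.+1 = (nth (0, 0) s0 j).1 /\
  nth 0 w j.*2.+2 = (nth (0, 0) s0 j).2.
Local Notation X := (word_bound K).

Lemma central_near (c : cell) : c \in s0 -> near K c.
Proof. by move=> /central; rewrite /near; lia. Qed.

Lemma F0_s0 c : c \in F0 -> c \in s0.
Proof. by rewrite !inE => /andP[]. Qed.

Lemma in_ends (c : cell) (s : slot) (d : cell) : s \in nbs c -> (s \in nbs d) = (d == c) || (d == other c s).
Proof.
rewrite !mem_nbs; case: s => -[] [px py]; case: c d => [x y] [x' y'];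
  rewrite /ends /other /= !inE !xpair_eqE /=; lia.
Qed.

Lemma near_other (c : cell) (s : slot) : c \in s0 -> s \in nbs c -> near K (other c s).
Proof.
move=> /central; rewrite mem_nbs; case: s => -[] [px py]; case: c => [x y];
  rewrite /near /ends /other /= !inE !xpair_eqE /=; lia.
Qed.

Lemma degree_del A s d : s \notin nbs d -> degree nbs (A `\ s) d = degree nbs A d.
Proof.
move=> sd; apply: eq_in_count => x xd /=; rewrite in_fsetD1.
by case: eqVneq => // e; rewrite -e xd in sd.
Qed.

(** The invariant of both scans: [k] cycles have been opened and [q] cells are left. Opening a cycle
    deletes a cell, whence the last clause, which keeps both counters small. *)
Record core (F : {fset cell}) (A : {fset slot}) (q k : nat) (m : int -> int) : Prop := Core {
  core_layout : layout K w lim (in_layout F A) m;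
  core_F : F `<=` F0;
  core_card : #|` A| = #|` F|;
  core_q : #|` F| = q;
  core_num : N0 = (2 ^ k * num_matchings nbs A F)%N;
  core_k : (k + q <= n)%N }.

(** Both kinds of deletion at once: at degree 1 the number of matchings is unchanged, at degree 2 it
    is halved, and the exponent [k + thr - 1] records this. *)
Lemma core_del F A q k m c s thr : core F A q k m -> c \in F -> s \in A -> s \in nbs c ->
  (thr = 1 \/ thr = 2 /\ forall d, d \in F -> degree nbs A d <> 1)%N ->
  degree nbs A c = thr ->
  core (F `\ c) (A `\ s) q.-1 (k + thr - 1)
    (upd (upd m (adr K 0 c) 0) (adr K (tag s.1) s.2) 0).
Proof.
case=> hm FF AF Fq NN kq cF sA sc hthr degc.
have cs0 := F0_s0 (fsubsetP FF _ cF).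
have := cardfsD1 c F; have := cardfsD1 s A; rewrite cF sA /= => cA cFF.
split.
- case: s {sA cA} sc => b p sc; apply: (layout_del_slot K9 limK).
    exact: near_nbs (central_near cs0) sc.
  apply: (layout_del_cell K9 limK) => //; exact/near_inr/central_near.
- by apply: fsubset_trans FF; exact: fsubD1set.
- by apply: (@addnI 1%N); rewrite -cA -cFF.
- by rewrite -Fq cFF.
- rewrite NN; case: hthr degc => [->|[-> deg1]] degc.
    by rewrite addnK (degree1_num_matchings sA cF sc degc).
  rewrite (degree2_num_matchings (ends := ends) _ uniq_nbs uniq_ends size_ends AF _ sA cF sc degc).
  + by rewrite mulnA -expnSr; congr (2 ^ _ * _)%N; lia.
  + by move=> *; exact: mem_nbs.
  + by move=> d dF; apply/eqP; exact: deg1.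
- move: kq; rewrite -Fq cFF; move: #|` _| => u; case: hthr => [->|[-> _]]; clear; lia.
Qed.

Lemma degree_le4 A c : (degree nbs A c <= 4)%N.
Proof. exact: count_size. Qed.

(* In the second scan ([thr0 = 2]) a cell that survives its visit shows that there is no
   matching. *)
Definition phase_inv (thr0 j : nat) (F : {fset cell}) (A : {fset slot}) : Prop :=
  (forall d, d \in F -> (thr0 = 2 \/ d \in take j s0) -> degree nbs A d <> 1)%N /\
  (thr0 = 2%N -> N0 = 0%N \/ forall d, d \in take j s0 -> d \notin F).

(** In a chain, [c] is the only settled cell that may have degree 1, and not even [c] while [thr] is
    2. Settled are the visited cells in the first scan and all cells in the second. By the last
    clause, in the second scan [cj] can be present only while its visit has deleted nothing. The 70
    units per cell left pay for its deletion. *)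
Definition chain_state (thr0 j phi : nat) (s : state) : Prop :=
  exists (F : {fset cell}) (A : {fset slot}) (c : cell) (thr q k : nat) m pe pf t,
  let deg := degree nbs A c in let x := (c \in F)%:Z * deg%:Z in
  let cj := nth (0, 0) s0 j in
  [/\ s = (regs K n.*2%:Z j.*2.+3%:Z (adr K 0 c) x deg%:Z pe pf t ((x - 1) * (thr%:Z - x))
             thr0%:Z thr%:Z q%:Z k%:Z lim%:Z, m),
     bounded X s,
     [/\ core F A q k m, near K c, phi = (70 * q)%N & looked K A c (nbs c) deg%:Z pe pf],
     (thr = 1 \/ thr = 2 /\ thr0 = 2 /\ c = cj)%N &
     [/\ (forall d, d \in F -> (thr0 = 2 \/ d \in take j.+1 s0) -> (d != c) || (thr == 2) ->
          degree nbs A d <> 1)%N,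
       thr0 = 2%N -> N0 = 0%N \/ forall d, d \in take j s0 -> d \notin F &
       thr0 = 2%N -> cj \in F -> thr = 2%N]].

Lemma nbs_range (c : cell) (s : slot) : near K c -> s \in nbs c ->
  (-K < s.2.1 < K) && (-K < s.2.2 < K) /\
  (-K < (other c s).1 < K) && (-K < (other c s).2 < K).
Proof.
rewrite mem_nbs; case: s => -[] [px py]; case: c => [x y];
  rewrite /near /ends /other /= !inE !xpair_eqE /=; move: K9; clear; lia.
Qed.

Lemma chain_state_bounded thr0 j phi s : chain_state thr0 j phi s -> bounded X s.
Proof. by case=> F [A [c [thr [q [k [m [pe [pf [t []]]]]]]]]]. Qed.

Lemma looked_bound A c pe pf : near K c -> looked K A c (nbs c) (degree nbs A c)%:Z pe pf ->
  (`|pe| <= X)%N /\ (`|pf| <= X)%N.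
Proof.
move=> hc [_]; case: ifP => _; last by case=> -> ->.
case=> s [sc _ -> ->]; split; apply: (adr_loose K9); rewrite ?tag_range // ?K9 //.
- exact: (nbs_range hc sc).1.
- exact: (nbs_range hc sc).2.
Qed.

Lemma chain_step thr0 j phi s : (0 < thr0 <= 2)%N -> (j < n)%N ->
  chain_state thr0 j phi s -> guard 0 21 s ->
  exists t s' phi', [/\ exe X L (Block (chain_kill ++ scan)) s t s',
    chain_state thr0 j phi' s' & (t + 2 + phi' <= phi)%N].
Proof.
move=> hthr0 jn [F [A [c [thr [q [k [m [pe [pf [t]]]]]]]]]] /=.
set deg := degree nbs A c; case=> sE sX [hcore cnear -> hlook] hthr [hdeg hdead hstart].
rewrite {1}sE /guard /= => hg.
(* Outside [F] the tested product would be [- thr], which is negative. *)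
have cF : c \in F by move: hg; case: (c \in F) => //; rewrite mul0r; case: hthr => [->|[->]].
move: hg; rewrite cF mul1r => hg.
have deg_thr : (0 < deg <= thr)%N by case: hthr hg => [->|[-> _]] hg; move: hg; nia.
have [_] := hlook; rewrite -/(degree nbs A c) -/deg; case/andP: (deg_thr) => -> degthr.
case=> sl [sc sA peE pfE].
have cs0 := F0_s0 (fsubsetP (core_F hcore) _ cF).
have alldeg : (thr = 1 \/ thr = 2 /\ forall d, d \in F -> degree nbs A d <> 1)%N.
  case: hthr => [|[thr2 [thr02 _]]]; [by left|right; split=> // d dF].
  by apply: hdeg => //; [left|rewrite thr2 eqxx orbT].
(* When [thr] is 2, degree 1 is excluded by the invariant, so the guard leaves only this value. *)
have degE : deg = thr.
  case: alldeg => [e|[e /(_ c cF)]]; rewrite -/deg; lia.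
have q0 : (0 < q)%N by rewrite -(core_q hcore) cardfs_gt0; apply/fset0Pn; exists c.
have hcore' := core_del hcore cF sA sc alldeg degE.
set F' := F `\ c in hcore'; set A' := A `\ sl in hcore'; set m' := upd _ _ _ in hcore'.
set c' := other c sl in pfE.
have c'near : near K c' by exact: near_other.
pose x0 := (c \in F)%:Z * deg%:Z; pose g0 := (x0 - 1) * (thr%:Z - x0).
pose s' := exec_block scan (regs K n.*2%:Z j.*2.+3%:Z (adr K 0 c') x0 deg%:Z pe pf t g0
  thr0%:Z 1%N%:Z (q.-1)%:Z (k + thr - 1)%N%:Z lim%:Z, m').
have [pe' [pf' [look' exe']]] : exists pe' pf', looked K A' c' (nbs c') (degree nbs A' c')%:Z pe' pf' /\
    s' = _ := scanE n.*2 _ _ _ _ _ _ _ _ _ _ _ _ c'near (core_layout hcore').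
have hs' : exec_block (chain_kill ++ scan) s = s'.
  rewrite exec_block_cat sE chain_killE addr0 /s' -pfE /m' -peE.
  have -> : q%:Z - 1 = (q.-1)%:Z by move: q0; clear; lia.
  by have -> : k%:Z + thr%:Z - 1 = (k + thr - 1)%N%:Z by move: deg_thr; clear; lia.
exists 55%N, s'.
exists (70 * q.-1)%N; split; last by lia.
  rewrite -hs' -[55%N]/(size (chain_kill ++ scan)).
  apply: (exe_block (word_bound_gt1 K9) _ _ sX); last exact: isT.
  by apply: leq_trans L100.
have [b1 b2] := looked_bound c'near look'.
have hdl := degree_le4 A' c'.
exists F', A', c', 1%N, q.-1, (k + thr - 1)%N, m', pe', pf', (1%N%:Z - (c' \in F')%:Z * (degree nbs A' c')%:Z).
split; [exact: exe'| |exact: And4 hcore' c'near erefl look'|by left|].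
- rewrite exe'; apply: (bounded_regs K9 (layout_mem (core_layout hcore'))).
    by rewrite /= b1 b2 (adr_near K9 zero_range c'near).
  have kn := core_k hcore'; have [_ thr02] := andP hthr0.
  exact: (@scan_small _ _ _ _ 1 _ _ _ _ _ nK limK jn hdl isT thr02 (leq_trans (leq_addl _ _) kn)
    (leq_trans (leq_addr _ _) kn)).
- split.
  (* Only the two ends of the deleted slot change degree; [c] is gone, so the exception moves from
     [c] to [c']. *)
  + move=> d; rewrite in_fsetD1 => /andP[dc dF] hd; rewrite orbF => dc'.
    rewrite degree_del; first by apply: (hdeg _ dF hd); rewrite dc.
    by rewrite (in_ends _ sc) (negPf dc) (negPf dc').
  + move=> /hdead [|h]; [by left|right => d /h]; rewrite in_fsetD1 => /negPf ->.
    by rewrite andbF.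
  + move=> thr02; rewrite in_fsetD1 => /andP[ne cjF].
    have thr2 := hstart thr02 cjF; case: hthr => [|[_ [_ e]]]; first by rewrite thr2.
    by rewrite e eqxx in ne.
Qed.



(** An unvisited entry carries 150 units for its block of 56 instructions and the jumps around it;
    chains spend the 70 units per cell left. Since a cell is deleted only once, chains of any length
    are amortised. *)
Definition phase_state (thr0 phi : nat) (s : state) : Prop :=
  exists j (F : {fset cell}) (A : {fset slot}) (q k : nat) m a x deg pe pf t g thr,
  [/\ s = (regs K n.*2%:Z j.*2.+1%:Z a x deg pe pf t g thr0%:Z thr q%:Z k%:Z lim%:Z, m),
     bounded X s, core F A q k m, (j <= n)%N /\ phi = (150 * (n - j) + 70 * q)%N &
     phase_inv thr0 j F A].

Lemma phase_state_bounded thr0 phi s : phase_state thr0 phi s -> bounded X s.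
Proof. by case=> j [F [A [q [k [m [a [x [deg [pe [pf [t [g [thr []]]]]]]]]]]]]]. Qed.

Lemma mem_take_nth j c : (j < n)%N -> (c \in take j.+1 s0) =
  (c \in take j s0) || (c == nth (0, 0) s0 j).
Proof. by move=> jn; rewrite (take_nth (0, 0)) // mem_rcons inE orbC. Qed.

Lemma phase_step thr0 phi s : (0 < thr0 <= 2)%N ->
  phase_state thr0 phi s -> guard 14 2 s ->
  exists t s' phi', [/\ exe X L (Seq (Block (load_cell ++ Add 23 22 0 :: scan)) chain) s t s',
    phase_state thr0 phi' s' & (t + 2 + phi' <= phi)%N].
Proof.
move=> hthr0 [j [F [A [q [k [m [a [x [deg [pe [pf [t [g [thr]]]]]]]]]]]]]].
case=> sE sX hcore [jn ->] [hdeg hdead]; rewrite {1}sE /guard /= => hg.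
have {jn hg} jn : (j < n)%N by move: hg; clear; lia.
pose cj := nth (0, 0) s0 j.
have cjs : cj \in s0 by exact: mem_nth.
have cjn := central_near cjs.
have [hw1 hw2] := s0w jn.
have [mw _ _] := core_layout hcore.
have limj : (j.*2.+2 <= lim)%N by rewrite /lim; move: jn; clear; lia.
have m1 : m j.*2.+1%:Z = cj.1 by rewrite mw ?hw1 // ltnW.
have m2 : m (j.*2.+1%:Z + 1) = cj.2.
  have -> : j.*2.+1%:Z + 1 = j.*2.+2%:Z by clear; lia.
  by rewrite mw ?hw2.
have [s1 [pe' [pf' [look' exe' hs']]]] : exists s1 pe' pf',
    let x' := (cj \in F)%:Z * (degree nbs A cj)%:Z in
    [/\ looked K A cj (nbs cj) (degree nbs A cj)%:Z pe' pf',
      s1 = (regs K n.*2%:Z j.*2.+3%:Z (adr K 0 cj) x' (degree nbs A cj)%:Z pe' pf' (thr0%:Z - x')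
        ((x' - 1) * (thr0%:Z - x')) thr0%:Z thr0%:Z q%:Z k%:Z lim%:Z, m) &
      exec_block (load_cell ++ Add 23 22 0 :: scan) s = s1].
  have [pe' [pf' [look' exe']]] := scanE n.*2 j.*2.+3%:Z x deg pe pf cj.2 g thr0%:Z
    thr0%:Z q%:Z k%:Z lim%:Z cjn (core_layout hcore).
  eexists; exists pe', pf'; split; [exact: look'|exact: exe'|].
  rewrite sE exec_block_cat load_cellE -[Add 23 22 0 :: scan]cat1s exec_block_cat set_thrE m1 m2.
  rewrite /adr mul0r !addr0.
  by have -> : j.*2.+1%:Z + 1 + 1 = j.*2.+3%:Z by clear; lia.
have [b1 b2] := looked_bound cjn look'.
have hdl := degree_le4 A cj.
have hscan : chain_state thr0 j (70 * q) s1.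
  exists F, A, cj, thr0, q, k, m, pe', pf',
    (thr0%:Z - (cj \in F)%:Z * (degree nbs A cj)%:Z).
  split; [exact: exe'| |exact: And4 hcore cjn erefl look'| |].
  - rewrite exe'; apply: (bounded_regs K9 (layout_mem (core_layout hcore))).
      by rewrite /= b1 b2 (adr_near K9 zero_range cjn).
    have kn := core_k hcore; have [_ thr02] := andP hthr0.
    exact: (@scan_small _ _ _ _ _ _ _ _ _ _ nK limK jn hdl hthr0 thr02 (leq_trans (leq_addl _ _) kn)
      (leq_trans (leq_addr _ _) kn)).
  - have [->|->] : thr0 = 1%N \/ thr0 = 2%N by move: hthr0; clear; lia.
      by left.
    by right.
  - split.
    + move=> d dF; rewrite mem_take_nth // => hd dc; apply: (hdeg _ dF).
      case: hd => [|/orP[]]; [by left|by right|move=> /eqP e].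
      by move: dc; rewrite e eqxx /= => /eqP; left.
    + exact: hdead.
    + by [].
have [t' [s' [phi' [e' hch ng tphi]]]] := exe_while (word_bound_gt1 K9)
  (fun phi s (h : chain_state thr0 j phi s) => chain_state_bounded h)
  (fun phi s => chain_step hthr0 jn) hscan.
exists (56 + t')%N, s', (150 * (n - j.+1) + phi')%N; split; last first.
- by move: tphi jn; clear; lia.
- case: hch => F' [A' [c' [thr' [q' [k' [m' [pe2 [pf2 [t2]]]]]]]]] /=.
  case=> s'E s'X [hcore' c'near -> look2] hthr' [hdeg' hdead' hstart'].
  exists j.+1, F', A', q', k', m'; do 8 eexists; split; [exact: s'E|exact: s'X|exact: hcore'|by []|].
  move: ng; rewrite s'E /guard /= => ng.
  (* The chain has stopped, so the product is negative: this excludes degree 1, and also degree 2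
     when [thr'] is 2. *)
  have c'deg : c' \in F' -> (degree nbs A' c' <> 1 /\ (thr' = 2 -> degree nbs A' c' <> 2))%N.
    move=> c'F; move: ng; rewrite c'F mul1r; case: hthr' => [|[]] -> => [|_]; nia.
  have hdeg2 d : d \in F' -> (thr0 = 2 \/ d \in take j.+1 s0) -> degree nbs A' d <> 1%N.
    move=> dF hd; have [e|ne] := eqVneq d c'; first by rewrite e in dF *; case: (c'deg dF).
    by apply: (hdeg' _ dF hd); rewrite ne.
  split=> // thr02; have [|dead] := hdead' thr02; first by left.
  (* If [cj] survives, its visit deleted nothing and its degree is not 2, although no cell has
     degree 1; by [num_matchings_eq0] there is no matching. *)
  have [cjF|cjF] := boolP (cj \in F'); last first.
    right=> d; rewrite mem_take_nth // => /orP[/dead //|/eqP ->]; exact: cjF.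
  have thr2 := hstart' thr02 cjF.
  have c'E : c' = cj by case: hthr' => [|[_ []] //]; rewrite thr2.
  left; rewrite (core_num hcore').
  rewrite (num_matchings_eq0 mem_nbs uniq_nbs uniq_ends size_ends (core_card hcore') _ cjF) ?muln0 //.
    by move=> d dF; apply/eqP; apply: hdeg2 => //; left.
  by rewrite -c'E in cjF *; apply/eqP; have [_] := c'deg cjF; apply.
- apply: exe_seq e'; rewrite -hs' -[56%N]/(size (load_cell ++ Add 23 22 0 :: scan)).
  apply: (exe_block (word_bound_gt1 K9) _ _ sX); last exact: isT.
  by apply: leq_trans L100.
Qed.

Lemma phase_correct thr0 F A q k m a x deg pe pf t g thr :
  (0 < thr0 <= 2)%N ->
  let s := (regs K n.*2%:Z 1 a x deg pe pf t g thr0%:Z thr q%:Z k%:Z lim%:Z, m) in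
  bounded X s -> core F A q k m -> phase_inv thr0 0 F A ->
  exists (t1 : nat) F' A' (q' k' : nat) m' i' a' x' deg' pe' pf' t' g' thr',
  let s' := (regs K n.*2%:Z i' a' x' deg' pe' pf' t' g' thr0%:Z thr' q'%:Z k'%:Z lim%:Z, m') in
  [/\ exe X L phase s t1 s', bounded X s', core F' A' q' k' m', phase_inv thr0 n F' A' &
    (t1 + 70 * q' <= 150 * n + 70 * q + 2)%N].
Proof.
move=> hthr0 s sX hcore hinv.
have h0 : phase_state thr0 (150 * n + 70 * q) s.
  exists 0%N, F, A, q, k, m; do 8 eexists; split; [reflexivity|exact: sX|exact: hcore| |exact: hinv].
  by rewrite subn0.
have [t' [s' [phi' [e' hst ng tphi]]]] := exe_while (word_bound_gt1 K9)
  (fun phi s (h : phase_state thr0 phi s) => phase_state_bounded h)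
  (fun phi s => phase_step hthr0) h0.
case: hst => j [F' [A' [q' [k' [m' [a' [x' [deg' [pe' [pf' [t2 [g' [thr']]]]]]]]]]]]].
case=> s'E s'X hcore' [jn phiE] hinv'.
move: ng; rewrite s'E /guard /= => ng.
have jE : j = n by move: jn ng; clear; lia.
rewrite jE in hinv'; rewrite s'E in e' s'X.
exists t', F', A', q', k', m'; do 9 eexists; split; [exact: e'|exact: s'X|exact: hcore'|exact: hinv'|].
by move: tphi; rewrite phiE; clear; lia.
Qed.

End Phases.

(** * Initialisation and output *)

Section Fill.
Variables (K : int) (s0 p0 : seq cell) (w : seq int) (L : nat).
Hypothesis K9 : 9 <= K.
Hypothesis L100 : (100 <= L)%N.
Local Open Scope fset_scope.
Local Open Scope ring_scope.

Let n := size s0.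
Let lim := (n.*2 + 1 + (size p0).*2)%N.
Local Notation X := (word_bound K).

Hypothesis nK : n.*2%:Z + 9 <= K.
Hypothesis limK : lim%:Z < K + K.
Hypothesis s0K : forall c : cell, c \in s0 -> near K c.
Hypothesis s0w : forall j, (j < n)%N -> nth 0 w j.*2.+1 = (nth (0, 0) s0 j).1 /\
  nth 0 w j.*2.+2 = (nth (0, 0) s0 j).2.
Hypothesis p0w : forall j, (j < size p0)%N ->
  nth 0 w (n + j).*2.+2 = (nth (0, 0) p0 j).1 /\
  nth 0 w (n + j).*2.+3 = (nth (0, 0) p0 j).2.
Hypothesis p0s0 : {subset p0 <= s0}.

Definition fill_regs (i a t q : int) : seq int :=
  regs K n.*2%:Z i a 0 0 0 0 t 0 0 0 q 0 lim%:Z.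

Lemma bounded_fill (i q : nat) a (t' : int) m : (forall b, (`|m b| <= X)%N) ->
  (`|a| <= X)%N -> (i <= lim.+1)%N -> (`|t'| <= `|(K + K)%R|)%N -> (q <= n)%N ->
  bounded X (fill_regs i%:Z a t' q%:Z, m).
Proof.
move=> hm ha hi ht hq; apply: (bounded_regs K9 hm); first by rewrite /= ha.
have hlim : (lim%:Z < K + K) := limK; have hn := nK.
rewrite /= ht !andbT; move: hi hq hlim hn; move: lim n K9 => l n' K9' hi hq hlim hn.
by clear -hi hq hlim hn; repeat (apply/andP; split); lia.
Qed.

Lemma near_small (c : cell) : near K c -> (`|c.2| <= `|(K + K)%R|)%N.
Proof. by rewrite /near; clear; lia. Qed.

Lemma load_cell_fill c (i : nat) a t q m : m i%:Z = c.1 -> m i.+1%:Z = c.2 ->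
  exec_block load_cell (fill_regs i%:Z a t q, m) =
  (fill_regs i.+2%:Z (adr K 0 c) c.2 q, m).
Proof.
move=> m1 m2; rewrite /fill_regs load_cellE m1.
have -> : i%:Z + 1 = i.+1%:Z by clear; lia.
rewrite m2 /adr mul0r addr0.
by have -> : i.+1%:Z + 1 = i.+2%:Z by clear; lia.
Qed.

Definition fill_cells_state (q : nat) (phi : nat) (s : state) : Prop :=
  exists j a t m,
  [/\ s = (fill_regs j.*2.+1%:Z a t q%:Z, m), bounded X s,
      layout K w lim (in_layout [fset c in take j s0] fset0) m &
      (j <= n)%N /\ phi = (10 * (n - j))%N].

Lemma fset_take_nth (s : seq cell) j : (j < size s)%N ->
  [fset c in take j.+1 s] = nth (0, 0) s j |` [fset c in take j s].
Proof.
move=> js; apply/fsetP => c; rewrite in_fset1U !inE /=.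
by rewrite (take_nth (0, 0)) // mem_rcons inE.
Qed.

Lemma fill_cells_step q phi s : (q <= n)%N ->
  fill_cells_state q phi s -> guard 14 2 s ->
  exists t s' phi', [/\ exe X L (Block (load_cell ++ [:: Write 15 1])) s t s',
    fill_cells_state q phi' s' & (t + 2 + phi' <= phi)%N].
Proof.
move=> qn [j [a [t [m [sE sX hl [jn ->]]]]]]; rewrite {1}sE /guard /= => hg.
have {jn hg} jn : (j < n)%N by move: hg; clear; lia.
pose c := nth (0, 0) s0 j.
have cn : near K c by apply/s0K/mem_nth.
have [hw1 hw2] := s0w jn; have [mw _ _] := hl.
have limj : (j.*2.+2 <= lim)%N by rewrite /lim; move: jn; clear; lia.
have hs' : exec_block (load_cell ++ [:: Write 15 1]) s =
    (fill_regs j.+1.*2.+1%:Z (adr K 0 c) c.2 q%:Z, upd m (adr K 0 c) 1).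
  rewrite exec_block_cat sE (load_cell_fill (c := c)) //; first by rewrite mw ?hw1 // ltnW.
  by rewrite mw ?hw2.
have hl' := layout_add_cell K9 limK (near_inr cn) hl.
exists 8%N, (fill_regs j.+1.*2.+1%:Z (adr K 0 c) c.2 q%:Z, upd m (adr K 0 c) 1).
exists (10 * (n - j.+1))%N; split; last by move: jn; clear; lia.
  rewrite -hs' -[8%N]/(size (load_cell ++ [:: Write 15 1])).
  apply: (exe_block (word_bound_gt1 K9) _ _ sX); last exact: isT.
  by apply: leq_trans L100.
exists j.+1, (adr K 0 c), c.2, (upd m (adr K 0 c) 1); split; [by []| | |by []].
- apply: (bounded_fill (layout_mem hl') _ _ _ qn); [exact: (adr_near K9)|exact: limj|exact: near_small].
- by rewrite fset_take_nth.
Qed.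

(** The word counting the pegs precedes their coordinates, which shifts the positions from odd to
    even. *)
Definition fill_pegs_state (q : nat) (phi : nat) (s : state) : Prop :=
  exists j a t m,
  [/\ s = (fill_regs (n + j).*2.+2%:Z a t q%:Z, m), bounded X s,
      layout K w lim (in_layout [fset c in s0 | c \notin take j p0] (slots [fset c in take j p0])) m &
      (j <= size p0)%N /\ phi = (14 * (size p0 - j))%N].

Lemma fill_pegs_step q phi s : (q <= n)%N ->
  fill_pegs_state q phi s -> guard 14 26 s ->
  exists t s' phi', [/\ exe X L (Block (load_cell ++
    [:: Write 15 0; Add 15 15 3; Write 15 1; Add 15 15 3; Write 15 1])) s t s',
    fill_pegs_state q phi' s' & (t + 2 + phi' <= phi)%N].
Proof.
move=> qn [j [a [t [m [sE sX hl [jn ->]]]]]]; rewrite {1}sE /guard /= => hg.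
have {jn hg} jn : (j < size p0)%N by move: hg; rewrite /lim; clear; lia.
pose c := nth (0, 0) p0 j.
have cn : near K c by apply/s0K/p0s0/mem_nth.
have [hw1 hw2] := p0w jn; have [mw _ _] := hl.
have limj : ((n + j).*2.+3 <= lim)%N by rewrite /lim; move: jn; clear; lia.
pose m' := upd (upd (upd m (adr K 0 c) 0) (adr K (tag true) c) 1) (adr K (tag false) c) 1.
have hs' : exec_block (load_cell ++
    [:: Write 15 0; Add 15 15 3; Write 15 1; Add 15 15 3; Write 15 1]) s =
    (fill_regs (n + j.+1).*2.+2%:Z (adr K 2 c) c.2 q%:Z, m').
  rewrite exec_block_cat sE (load_cell_fill (c := c)); last first.
  - by rewrite mw ?hw2.
  - by rewrite mw ?hw1 // ltnW.
  have e1 : adr K 0 c + K = adr K (tag true) c by rewrite /adr /=; ring.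
  have e2 : adr K (tag true) c + K = adr K (tag false) c by rewrite /adr /=; ring.
  by rewrite /m' -[adr K 2 c]/(adr K (tag false) c) -e2 -e1 addnS.
have hl' := layout_add_slot K9 limK false (near_inr cn)
  (layout_add_slot K9 limK true (near_inr cn) (layout_del_cell K9 limK (near_inr cn) hl)).
exists 12%N, (fill_regs (n + j.+1).*2.+2%:Z (adr K 2 c) c.2 q%:Z, m').
exists (14 * (size p0 - j.+1))%N; split; last by move: jn; clear; lia.
  rewrite -hs' -[12%N]/(size (load_cell ++
    [:: Write 15 0; Add 15 15 3; Write 15 1; Add 15 15 3; Write 15 1])).
  apply: (exe_block (word_bound_gt1 K9) _ _ sX); last exact: isT.
  by apply: leq_trans L100.
exists j.+1, (adr K 2 c), c.2, m'; split; [by []| | |by []].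
- apply: (bounded_fill (layout_mem hl') _ _ _ qn); [exact: (adr_near K9)| |exact: near_small].
  by move: limj; clear; lia.
- apply: layout_ext hl' => u d hu; rewrite /in_layout fset_take_nth // !in_fset1U in_fsetD1.
  case: (u == 0); rewrite ?in_slots !inE /=.
    by rewrite (take_nth (0, 0)) // mem_rcons inE negb_or andbCA.
  by rewrite !xpair_eqE; case: (u == 1); case: (d == c).
Qed.

End Fill.

(** * The parameter [K] as a sum of squares *)

Fixpoint square_sum (w : seq int) (i : nat) : int :=
  if i is j.+1 then square_sum w j + nth 0 w j * nth 0 w j + nth 0 w j * nth 0 w j
  else 4 + 4 + 1.

Lemma square_sum_le w i j : (i <= j)%N -> square_sum w i <= square_sum w j.
Proof.
elim: j => [|j IH]; first by rewrite leqn0 => /eqP ->.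
rewrite leq_eqVlt => /orP[/eqP -> //|/IH h] /=; nia.
Qed.

Lemma square_sum_ge9 w i : 9 <= square_sum w i.
Proof. exact: (@square_sum_le w 0 i). Qed.

(** An integer is at most its square in absolute value, and each square enters twice on top of the
    initial 9. *)
Lemma nth_square_sum w i j : (i < j)%N ->
  `|nth 0 w i| + `|nth 0 w i| + 9 <= square_sum w j /\ nth 0 w i * nth 0 w i <= square_sum w j.
Proof.
move=> /(square_sum_le w) /=; have := square_sum_ge9 w i; move: (nth _ _ _) => z; nia.
Qed.

Lemma square_sum_bound w (B i : nat) : (forall j, (`|nth 0%R w j| <= B)%N) ->
  square_sum w i <= 9 + 2 * i%:Z * (B%:Z * B%:Z).
Proof.
move=> hB; elim: i => [|i IH] /=; first by rewrite mulr0 mul0r.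
have := hB i; move: (nth _ _ _) => z hz; have : z * z <= B%:Z * B%:Z by nia.
by move: IH; clear; lia.
Qed.

Lemma size_encode_cells s : size (encode_cells s) = (size s).*2.+1.
Proof. by rewrite /encode_cells /=; congr _.+1; elim: s => //= c s ->. Qed.

Lemma nth_encode_cells (s : seq cell) r j : (j < size s)%N ->
  nth 0 (encode_cells s ++ r) j.*2.+1 = (nth (0, 0) s j).1 /\
  nth 0 (encode_cells s ++ r) j.*2.+2 = (nth (0, 0) s j).2.
Proof. by rewrite /encode_cells /=; elim: s j => // c s IH [|j] //= /IH. Qed.

Section Start.
Variables (w : seq int) (n L : nat) (m : int -> int) (q p : nat).
Hypothesis L100 : (100 <= L)%N.
Let K := square_sum w n.*2.+1.
Local Notation X := (word_bound K).
Hypothesis mX : forall a, (`|m a| <= X)%N.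
Hypothesis mw : forall j, (j <= n.*2.+1)%N -> m j%:Z = nth 0 w j.
Hypothesis w0 : nth 0 w 0 = n%:Z.
Hypothesis wp : nth 0 w n.*2.+1 = p%:Z.
Hypothesis pn : (q + p = n)%N.

Let K9 : 9 <= K. Proof. exact: square_sum_ge9. Qed.

Let nK : n.*2%:Z + 9 <= K.
Proof. have [+ _] := @nth_square_sum w 0 n.*2.+1 isT; rewrite w0 -/K; clear; lia. Qed.

Definition sum_regs (k i t : int) : seq int :=
  [:: 0; 1; n%:Z + n%:Z; k; 0; 0; 0; 0; 0; 0; 0; 0; 0; 0; i; 0; 0; 0; 0; 0; t; 0; 0; 0; n%:Z; 0; 0].

Lemma bounded_sum (i : nat) (k t : int) : (i <= n.*2.+1)%N -> 0 <= k <= K -> 0 <= t <= K ->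
  bounded X (sum_regs k i%:Z t, m).
Proof.
move=> hi hk ht; split; last exact: mX.
have XK z : (`|z| <= `|(K + K)%R|)%N -> (`|z| <= X)%N.
  by move=> h; apply/(le_word_bound_small K9)/(leq_trans h); move: K9; clear; lia.
have h0 : (0 <= X)%N by [].
have h1 : (1 <= X)%N by apply: ltnW; exact: word_bound_gt1.
have h2 : (`|(n%:Z + n%:Z)%R| <= X)%N by apply: XK; move: nK; clear; lia.
have h3 : (`|k| <= X)%N by apply: XK; move: hk; clear; lia.
have h4 : (`|i%:Z| <= X)%N by apply: XK; move: hi nK; clear; lia.
have h5 : (`|t| <= X)%N by apply: XK; move: ht; clear; lia.
have h6 : (`|n%:Z| <= X)%N by apply: XK; move: nK; clear; lia.
by rewrite /= h2 h3 h4 h5 h6 h1.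
Qed.

Definition sum_state (phi : nat) (s : state) : Prop :=
  exists j t, [/\ s = (sum_regs (square_sum w j) j%:Z t, m), bounded X s &
    (j <= n.*2.+1)%N /\ phi = (7 * (n.*2.+1 - j))%N].

Lemma sum_step phi s : sum_state phi s -> guard 14 2 s ->
  exists t s' phi', [/\ exe X L (Block [:: Read 20 14; Mul 20 20 20; Add 3 3 20; Add 3 3 20;
    Add 14 14 1]) s t s', sum_state phi' s' & (t + 2 + phi' <= phi)%N].
Proof.
move=> [j [t [sE sX [jn ->]]]]; rewrite {1}sE /guard /= => hg.
have {hg} jn' : (j < n.*2.+1)%N by move: hg; clear; lia.
have [_ sqK] := nth_square_sum w jn'.
have hs' : exec_block [:: Read 20 14; Mul 20 20 20; Add 3 3 20; Add 3 3 20; Add 14 14 1] s =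
    (sum_regs (square_sum w j.+1) j.+1%:Z (nth 0 w j * nth 0 w j), m).
  rewrite sE -[LHS]/(sum_regs (square_sum w j + m j%:Z * m j%:Z + m j%:Z * m j%:Z) (j%:Z + 1)
    (m j%:Z * m j%:Z), m).
  have -> : j%:Z + 1 = j.+1%:Z by clear; lia.
  by rewrite mw.
exists 5%N; eexists; exists (7 * (n.*2.+1 - j.+1))%N; split; last by move: jn'; clear; lia.
  rewrite -[5%N]/(size [:: Read 20 14; Mul 20 20 20; Add 3 3 20; Add 3 3 20; Add 14 14 1]).
  apply: (exe_block (word_bound_gt1 K9) _ _ sX); last exact: isT.
  by apply: leq_trans L100.
rewrite hs'; exists j.+1, (nth 0 w j * nth 0 w j); split; [by []| |by []].
apply: bounded_sum => //.
  by have := square_sum_le w jn'; have := square_sum_ge9 w j.+1; rewrite -/K; clear; lia.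
by rewrite sqK andbT; clear; nia.
Qed.

Lemma start_correct :
  exists t (t' : int),
    exe X L start ([::], m) t
      (regs K n.*2%:Z 1 0 0 0 0 0 t' 0 0 0 q%:Z 0 (n.*2 + 1 + p.*2)%N%:Z, m) /\
    (t <= 14 * n + 40)%N /\ (`|t'| <= `|(K + K)%R|)%N.
Proof.
have b0 : bounded X ([::], m) by split.
have s0 : sum_state (7 * (n.*2.+1)) (sum_regs (square_sum w 0) 0 0, m).
  exists 0%N, 0; split; [by []| |by rewrite subn0].
  by apply: bounded_sum => //; have := square_sum_ge9 w 0; have := square_sum_le w (leq0n n.*2.+1); rewrite -/K; clear; lia.
have [t [s [phi [e hs ng tphi]]]] := exe_while (word_bound_gt1 K9)
  (fun phi s (h : sum_state phi s) => let: ex_intro _ (ex_intro _ (And3 _ b _)) := h in b)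
  sum_step s0.
case: hs => j [t' [sE sX [jn phiE]]].
have jE : j = n.*2.+1 by move: ng; rewrite sE /guard /= => ng; move: jn ng; clear; lia.
exists (7 + (t + 19))%N, p%:Z; split; last first.
  have [_ hp] : (p <= n)%N /\ (p <= n)%N by split; rewrite -pn leq_addl.
  by split; [move: tphi|move: hp nK]; clear; lia.
apply: exe_seq.
  rewrite -[7%N]/(size [:: Const 26 0; Const 1 1; Read 24 0; Add 2 24 24; Const 3 4; Add 3 3 3;
      Add 3 3 1]).
  apply: (exe_block (word_bound_gt1 K9) _ _ b0); last exact: isT.
  by apply: leq_trans L100.
have -> : exec_block [:: Const 26 0; Const 1 1; Read 24 0; Add 2 24 24; Const 3 4; Add 3 3 3;
      Add 3 3 1] ([::], m) = (sum_regs (square_sum w 0) 0 0, m).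
  by rewrite /sum_regs -[n%:Z]w0 -[nth _ _ _]mw.
apply: exe_seq e _; rewrite sE jE -/K.
rewrite (_ : (regs _ _ _ _ _ _ _ _ _ _ _ _ _ _ _, m) = exec_block
  [:: Mul 4 3 3; Add 4 4 4; Add 4 4 4; Add 4 4 4;
      Add 20 3 3; Add 13 20 3; Add 5 13 3; Add 6 13 13;
      Defs.Sub 7 0 20; Defs.Sub 8 0 6; Add 9 20 1; Const 10 2; Defs.Sub 11 20 1; Defs.Sub 12 0 10;
      Read 20 14; Defs.Sub 24 24 20; Add 26 14 20; Add 26 26 20; Const 14 1]
   (sum_regs K n.*2.+1%:Z t', m)).
  apply: (exe_block (word_bound_gt1 K9)); [by apply: leq_trans L100|exact: isT|].
  by rewrite sE jE in sX.
have -> : n.*2%:Z = n%:Z + n%:Z by clear; lia.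
have -> : (n.*2 + 1 + p.*2)%N%:Z = n.*2.+1%:Z + p%:Z + p%:Z by clear; lia.
have -> : q%:Z = n%:Z - p%:Z by move: pn; clear; lia.
by rewrite -wp -mw.
Qed.

End Start.

(** * Writing the result in binary *)

Lemma binary0 : binary [::] 0.
Proof. by split=> //; rewrite big_ord0. Qed.

Lemma binary_exp2 k : binary (rcons (nseq k 0%N) 1%N) (2 ^ k).
Proof.
split.
- by rewrite all_rcons all_nseq orbT.
- by rewrite last_rcons.
- rewrite size_rcons size_nseq big_ord_recr /= nth_rcons size_nseq ltnn eqxx mul1n.
  rewrite big1 // => i _; rewrite nth_rcons size_nseq ltn_ord nth_nseq ltn_ord.
  by rewrite mul0n.
Qed.

Section Output.
Variables (K n2 a x deg pe pf g thr0 thr lim : int) (L : nat).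
Hypothesis K9 : 9 <= K.
Hypothesis L100 : (100 <= L)%N.
Local Notation X := (word_bound K).
Let R (i t q k : int) := regs K n2 i a x deg pe pf t g thr0 thr q k lim.

Lemma bounded_out i t q k m i' t' q' k' m' : bounded X (R i t q k, m) ->
  (`|i'| <= X)%N -> (`|t'| <= X)%N -> (`|q'| <= X)%N -> (`|k'| <= X)%N ->
  (forall b, (`|m' b| <= X)%N) -> bounded X (R i' t' q' k', m').
Proof.
move=> [h _] hi ht hq hk hm; split; last exact: hm.
rewrite (_ : (R i' t' q' k', m').1 =
  set_nth 0 (set_nth 0 (set_nth 0 (set_nth 0 (R i t q k) 14 i') 20 t') 24 q') 25 k') //.
by do 4 apply: all_set_nth => //.
Qed.

(** The digits overwrite the input, so the [k] zeros below the leading 1 have to be written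
    explicitly. *)
Definition zero_state (k : nat) (i t q : int) (phi : nat) (s : state) : Prop :=
  exists j m, [/\ s = (R i t q j%:Z, m), bounded X s, (j <= k)%N /\ phi = (4 * j)%N &
    m k.+1%:Z = 1 /\ forall l, (j < l <= k)%N -> m l%:Z = 0].

Lemma upd_bounded m b v : (forall b', (`|m b'| <= X)%N) -> (`|v| <= X)%N ->
  forall b', (`|upd m b v b'| <= X)%N.
Proof. by move=> hm hv b'; rewrite /upd; case: eqP. Qed.

Lemma zero_step k i t q phi s : zero_state k i t q phi s -> guard 1 25 s ->
  exists t1 s' phi', [/\ exe X L (Block [:: Write 25 0; Defs.Sub 25 25 1]) s t1 s',
    zero_state k i t q phi' s' & (t1 + 2 + phi' <= phi)%N].
Proof.
move=> [j [m [sE sX [jk ->] [mk m0]]]]; rewrite {1}sE /guard /= => hg.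
have {hg} j0 : (0 < j)%N by move: hg; clear; lia.
have hs' : exec_block [:: Write 25 0; Defs.Sub 25 25 1] s = (R i t q (j.-1)%:Z, upd m j%:Z 0).
  rewrite sE -[LHS]/(R i t q (j%:Z - 1), upd m j%:Z 0).
  by have -> : (j.-1)%:Z = j%:Z - 1 by move: j0; clear; lia.
exists 2%N; eexists; exists (4 * j.-1)%N; split; last by move: j0; clear; lia.
  rewrite -[2%N]/(size [:: Write 25 0; Defs.Sub 25 25 1]).
  apply: (exe_block (word_bound_gt1 K9) _ _ sX); last exact: isT.
  by apply: leq_trans L100.
rewrite hs'; exists j.-1, (upd m j%:Z 0); split; [by []| | |].
- rewrite sE in sX; apply: (bounded_out sX).
  + exact: (bounded_nth 14 sX).
  + exact: (bounded_nth 20 sX).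
  + exact: (bounded_nth 24 sX).
  + have := bounded_nth 25 sX; rewrite /R /regs /=; apply: leq_trans; clear; lia.
  + by apply: upd_bounded => //; case: sX.
- by split=> //; move: jk; clear; lia.
- split.
    by rewrite /upd; case: eqP => // e; move: e jk; clear; lia.
  move=> l hl; rewrite /upd; case: eqP => // e; apply: m0.
  have /eqP : l <> j by move=> e'; apply: e; rewrite e'.
  by move: hl j0; clear; lia.
Qed.

Lemma output_correct i t (q k : nat) m :
  (k.+1%:Z <= K + K) -> bounded X (R i t q%:Z k%:Z, m) ->
  exists t1 s', [/\ exe X L output (R i t q%:Z k%:Z, m) t1 s', (t1 <= 4 * k + 20)%N &
    forall pc, outputs (conf pc s') (if q == 0%N then 2 ^ k else 0)%N].
Proof.
move=> kK sX; pose m1 := upd m (k%:Z + 1) 1; pose len : int := if q == 0%N then k%:Z + 1 else 0.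
have X1 := word_bound_gt1 K9.
have hk1 : (`|(k%:Z + 1)%R| <= X)%N.
  by apply: (le_word_bound_small K9); move: kK K9; clear; lia.
have h1 : (`|1%R| <= X)%N by exact: ltnW.
have hm1 : forall b, (`|m1 b| <= X)%N by apply: upd_bounded => //; case: sX.
have hk := bounded_nth 25 sX; have hq := bounded_nth 24 sX.
have s1X : bounded X (R (k%:Z + 1) (k%:Z + 1) q%:Z k%:Z, m1) by exact: (bounded_out sX).
have e1 : exe X L (Block [:: Add 20 25 1; Add 14 20 0; Write 20 1]) (R i t q%:Z k%:Z, m) 3
    (R (k%:Z + 1) (k%:Z + 1) q%:Z k%:Z, m1).
  have -> : (R (k%:Z + 1) (k%:Z + 1) q%:Z k%:Z, m1) =
      exec_block [:: Add 20 25 1; Add 14 20 0; Write 20 1] (R i t q%:Z k%:Z, m).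
    by rewrite -[RHS]/(R (k%:Z + 1 + 0) (k%:Z + 1) q%:Z k%:Z, m1) addr0.
  rewrite -[3%N]/(size [:: Add 20 25 1; Add 14 20 0; Write 20 1]).
  apply: (exe_block X1 _ _ sX); last exact: isT.
  by apply: leq_trans L100.
have [s2X [t2 [e2 ht2]]] : bounded X (R len (k%:Z + 1) 0 k%:Z, m1) /\ exists t2,
    exe X L (While 1 24 (Block [:: Add 14 0 0; Add 24 0 0]))
      (R (k%:Z + 1) (k%:Z + 1) q%:Z k%:Z, m1) t2 (R len (k%:Z + 1) 0 k%:Z, m1) /\ (t2 <= 6)%N.
  split; first by apply: (bounded_out sX) => //; rewrite /len; case: ifP.
  rewrite /len; case: eqP => [q0|q0].
    by exists 2; split=> //; rewrite q0 in s1X *; exact: exe_while_false.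
  (* Clearing register 24 makes the loop run once: two instructions, two jumps, and two steps to
     leave. *)
  exists (2 + 2 + 2)%N; split=> //.
  have s2X : bounded X (R 0 (k%:Z + 1) 0 k%:Z, m1) by exact: (bounded_out sX).
  apply: (exe_while_true X1 s1X s2X).
  - by rewrite /guard /=; move: q0; clear; lia.
  - have -> : (R 0 (k%:Z + 1) 0 k%:Z, m1) = exec_block [:: Add 14 0 0; Add 24 0 0]
        (R (k%:Z + 1) (k%:Z + 1) q%:Z k%:Z, m1).
      by rewrite -[RHS]/(R (0 + 0) (k%:Z + 1) (0 + 0) k%:Z, m1) addr0.
    rewrite -[X in exe _ _ _ _ X]/(size [:: Add 14 0 0; Add 24 0 0]).
    apply: (exe_block X1 _ _ s1X); last exact: isT.
    by apply: leq_trans L100.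
  - exact: exe_while_false.
have z0 : zero_state k len (k%:Z + 1) 0 (4 * k) (R len (k%:Z + 1) 0 k%:Z, m1).
  exists k, m1; split; [by []|exact: s2X|by []|split].
    by rewrite /m1 /upd (_ : k.+1%:Z = k%:Z + 1) ?eqxx //; clear; lia.
  by move=> l; clear; lia.
have [t3 [s3 [phi [e3 hz ng tphi]]]] := exe_while X1
  (fun phi s (h : zero_state k len (k%:Z + 1) 0 phi s) =>
     let: ex_intro _ (ex_intro _ (And4 _ b _ _)) := h in b)
  (fun phi s => @zero_step k len (k%:Z + 1) 0 phi s) z0.
case: hz => j [m3 [s3E s3X [jk phiE] [mk mz]]].
have j0 : j = 0%N by move: ng; rewrite s3E /guard /=; clear; lia.
rewrite j0 in mz.
exists (3 + (t2 + (t3 + 1)))%N, (R len (k%:Z + 1) 0 j%:Z, upd m3 0 len); split.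
- apply: exe_seq e1 (exe_seq e2 (exe_seq e3 _)); rewrite s3E in s3X *.
  rewrite -[1%N]/(size [:: Write 0 14]).
  apply: (exe_block X1 _ _ s3X); last exact: isT.
  by apply: leq_trans L100.
- by move: tphi ht2; clear; lia.
- move=> pc; rewrite /len; case: ifP => _; last first.
    by exists [::]; [exact: binary0|split].
  exists (rcons (nseq k 0%N) 1%N); first exact: binary_exp2.
  rewrite /= size_rcons size_nseq; split.
    by rewrite /upd eqxx; clear; lia.
  move=> l lk; rewrite /upd; case: eqP => // _.
  move: lk; rewrite ltnS leq_eqVlt nth_rcons size_nseq nth_nseq => /orP[/eqP ->|lk].
    by rewrite ltnn eqxx.
  by rewrite lk; apply: mz; rewrite lk.
Qed.

End Output.

(** * Correctness and running time *)

Lemma bounded_set_nth B l m r z : bounded B (l, m) -> (`|z| <= B)%N ->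
  bounded B (set_nth 0 l r z, m).
Proof. by move=> [hl hm] hz; split=> //; exact: all_set_nth. Qed.

(** The number of cells is itself an input word, so [n <= b], and [K] is at most quartic in the
    largest input word. *)
Lemma quartic_bound (n b : nat) (k : int) : (n <= b)%N ->
  k <= 9 + 2 * n.*2.+1%:Z * (b%:Z * b%:Z) -> k <= (b%:Z + 2) ^+ 4.
Proof.
move=> nb /le_trans; apply.
have -> : n.*2.+1%:Z = n%:Z + n%:Z + 1 by clear; lia.
have nb' : n%:Z <= b%:Z by [].
move: nb' (isT : 0 <= b%:Z); move: (n%:Z) (b%:Z) => x y {nb} xy y0.
have h1 : x * (y * y) <= y * (y * y) by rewrite ler_wpM2r // mulr_ge0.
have h2 : 0 <= y * y by rewrite mulr_ge0.
have h3 : 0 <= y * (y * y) by rewrite mulr_ge0.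
have h4 : 0 <= y * (y * (y * y)) by rewrite mulr_ge0.
have -> : (y + 2) ^+ 4 = y * (y * (y * y)) + 8 * (y * (y * y)) + 24 * (y * y) + 32 * y + 16.
  by ring.
by move: y0 h1 h2 h3 h4; clear; lia.
Qed.

Section Counter.
Variables (s0 p0 : seq cell) (L : nat).
Hypothesis L100 : (100 <= L)%N.
Hypothesis us0 : uniq s0.
Hypothesis up0 : uniq p0.
Hypothesis p0s0 : {subset p0 <= s0}.
Hypothesis size_p0 : (size s0 = 3 * size p0)%N.

Let n := size s0.
Let w := encode_cells s0 ++ encode_cells p0.
Let K := square_sum w n.*2.+1.
Let lim := (n.*2 + 1 + (size p0).*2)%N.
Let F0 := [fset c in s0 | c \notin p0]%fset.
Let A0 := slots [fset p in p0]%fset.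
Local Notation X := (word_bound K).

Let K9 : 9 <= K. Proof. exact: square_sum_ge9. Qed.

Let s0w j : (j < n)%N -> nth 0 w j.*2.+1 = (nth (0, 0) s0 j).1 /\
  nth 0 w j.*2.+2 = (nth (0, 0) s0 j).2.
Proof. exact: nth_encode_cells. Qed.

Let w_right j : nth 0 w (n.*2.+1 + j) = nth 0 (encode_cells p0) j.
Proof. by rewrite nth_cat size_encode_cells ltnNge leq_addr /= addKn. Qed.

Let p0w j : (j < size p0)%N -> nth 0 w (n + j).*2.+2 = (nth (0, 0) p0 j).1 /\
  nth 0 w (n + j).*2.+3 = (nth (0, 0) p0 j).2.
Proof.
move=> /(nth_encode_cells [::]); rewrite cats0 -!w_right.
have -> : (n.*2.+1 + j.*2.+1 = (n + j).*2.+2)%N by clear; lia.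
by have -> : (n.*2.+1 + j.*2.+2 = (n + j).*2.+3)%N by clear; lia.
Qed.

Let w0 : nth 0 w 0 = n%:Z. Proof. by []. Qed.

Let wp : nth 0 w n.*2.+1 = (size p0)%:Z.
Proof. by have := w_right 0; rewrite addn0. Qed.

Let size_w : size w = lim.+1.
Proof. by rewrite size_cat !size_encode_cells /lim -/n; clear; lia. Qed.

Let nK : n.*2%:Z + 9 <= K.
Proof. have [+ _] := @nth_square_sum w 0 n.*2.+1 isT; rewrite w0 -/K; clear; lia. Qed.

Let limK : lim%:Z < K + K.
Proof. by rewrite /lim; move: nK (size_p0); rewrite -/n; clear; lia. Qed.

Let s0_bound (c : cell) : c \in s0 -> `|c.1| + `|c.1| + 9 <= K /\ `|c.2| + `|c.2| + 9 <= K.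
Proof.
move=> cs; have jn : (index c s0 < n)%N by rewrite index_mem.
have [<- <-] : nth 0 w (index c s0).*2.+1 = c.1 /\ nth 0 w (index c s0).*2.+2 = c.2.
  by have := s0w jn; rewrite nth_index.
by split; [have [] := @nth_square_sum w (index c s0).*2.+1 n.*2.+1 _|
  have [] := @nth_square_sum w (index c s0).*2.+2 n.*2.+1 _] => //; move: jn; clear; lia.
Qed.

Let central (c : cell) : c \in s0 -> (-K < c.1 + c.1 - 6) && (c.1 + c.1 + 6 < K) &&
  (-K < c.2 + c.2 - 6) && (c.2 + c.2 + 6 < K).
Proof. by move=> /s0_bound; clear; lia. Qed.

Let s0K (c : cell) : c \in s0 -> near K c.
Proof. by move=> /s0_bound; rewrite /near; clear; lia. Qed.

(** Peg coordinates are covered because they are also coordinates of cells, and the number of pegs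
    is at most [n]. *)
Let wK j : `|nth 0 w j| <= K.
Proof.
have half (k z : int) : `|z| + `|z| + 9 <= k -> `|z| <= k by clear; lia.
have [jn|jn] := ltnP j n.*2.+1.
  by have [+ _] := nth_square_sum w jn; exact: half.
rewrite -(subnKC jn); case: (j - _)%N => [|i].
  by rewrite addn0 wp; move: nK size_p0; rewrite -/n; clear; lia.
have [ip|ip] := ltnP i./2 (size p0); last first.
  rewrite w_right nth_default; first by move: K9; clear; lia.
  by rewrite size_encode_cells; move: ip; clear; lia.
have [h1 h2] := s0_bound (p0s0 (mem_nth (0, 0) ip)).
have [e1 e2] := p0w ip.
have [e|e] : (n.*2.+1 + i.+1 = (n + i./2).*2.+2 \/ n.*2.+1 + i.+1 = (n + i./2).*2.+3)%N.
- by clear; lia.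
- by rewrite e e1; exact: half.
- by rewrite e e2; exact: half.
Qed.

Let m0 := memory (initial w).

Let m0X a : (`|m0 a| <= X)%N.
Proof.
apply: (le_word_bound_small K9); rewrite /m0 /=; case: ifP => _; last by [].
have dbl (k z : int) : 9 <= k -> `|z| <= k -> (`|z| <= `|(8 * k)%R|)%N by clear; lia.
exact: dbl K9 (wK _).
Qed.

Let m0w (j : nat) : m0 j%:Z = nth 0 w j. Proof. by []. Qed.

(** The table is empty at the start: its addresses lie beyond the input, where the memory is 0. *)
Let layout0 : layout K w lim (in_layout [fset c in take 0 s0]%fset fset0) m0.
Proof.
split=> // t c ht hc.
have := adr_bound K9 ht hc; set b := adr K t c => hb.
have -> : in_layout [fset c in take 0 s0]%fset fset0 t c = false.
  by rewrite /in_layout take0; case: ifP => _; rewrite ?inE.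
rewrite /m0 /=; case: ifP => // _; rewrite nth_default // size_w.
by move: limK hb; clear; lia.
Qed.

Let card_A0 : #|` A0| = (2 * size p0)%N.
Proof. by rewrite card_slots card_fseq undup_id. Qed.

Let card_F0 : #|` F0| = (n - size p0)%N.
Proof.
have -> : F0 = ([fset c in s0] `\` [fset c in p0])%fset.
  by apply/fsetP => c; rewrite in_fsetD !inE /= andbC.
rewrite cardfsDS; last by apply/fsubsetP => c; rewrite !inE; exact: p0s0.
by rewrite !card_fseq !undup_id.
Qed.

Let q0 := (n - size p0)%N.

Let q0n : (q0 <= n)%N. Proof. exact: leq_subr. Qed.

Let fill_cells_correct t : (`|t| <= `|(K + K)%R|)%N -> exists t1 m a t',
  [/\ exe X L fill_cells (fill_regs K s0 p0 1 0 t q0%:Z, m0) t1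
       (fill_regs K s0 p0 n.*2.+1%:Z a t' q0%:Z, m), (t1 <= 10 * n + 2)%N,
    bounded X (fill_regs K s0 p0 n.*2.+1%:Z a t' q0%:Z, m) &
    layout K w lim (in_layout [fset c in s0]%fset fset0) m].
Proof.
move=> ht.
have h0 : fill_cells_state K s0 p0 w q0 (10 * n) (fill_regs K s0 p0 1 0 t q0%:Z, m0).
  exists 0%N, 0, t, m0; split; [by []| |exact: layout0|by rewrite subn0].
  exact: (bounded_fill K9 nK limK (i := 1) m0X).
have [t1 [s' [phi' [e [j [a [t' [m [sE sX hl [jn _]]]]]] ng ht1]]]] := exe_while (word_bound_gt1 K9)
  (fun phi s (h : fill_cells_state K s0 p0 w q0 phi s) =>
     let: ex_intro _ (ex_intro _ (ex_intro _ (ex_intro _ (And4 _ b _ _)))) := h in b)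
  (fun phi s => @fill_cells_step K s0 p0 w L K9 L100 nK limK s0K s0w q0 phi s q0n) h0.
have jE : j = n by move: ng jn; rewrite sE /guard /= -/n; clear; lia.
rewrite sE jE in e sX; rewrite jE take_size in hl.
by exists t1, m, a, t'; split=> //; move: ht1; clear; lia.
Qed.

Let fill_pegs_correct a t m :
  bounded X (fill_regs K s0 p0 n.*2.+2%:Z a t q0%:Z, m) ->
  layout K w lim (in_layout [fset c in s0]%fset fset0) m ->
  exists t1 m' i' a' t',
  [/\ exe X L fill_pegs (fill_regs K s0 p0 n.*2.+2%:Z a t q0%:Z, m) t1
       (fill_regs K s0 p0 i' a' t' q0%:Z, m'), (t1 <= 14 * size p0 + 2)%N,
    bounded X (fill_regs K s0 p0 i' a' t' q0%:Z, m') &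
    layout K w lim (in_layout F0 A0) m'].
Proof.
move=> sX hl.
have h0 : fill_pegs_state K s0 p0 w q0 (14 * size p0) (fill_regs K s0 p0 n.*2.+2%:Z a t q0%:Z, m).
  exists 0%N, a, t, m; rewrite addn0 subn0; split=> //.
  apply: layout_ext hl => u c _; rewrite /in_layout take0; case: ifP => _.
    by rewrite !inE andbT.
  by rewrite in_slots !inE.
have [t1 [s' [phi' [e [j [a' [t' [m' [sE s'X hl' [jn _]]]]]] ng ht1]]]] :=
  exe_while (word_bound_gt1 K9)
  (fun phi s (h : fill_pegs_state K s0 p0 w q0 phi s) =>
     let: ex_intro _ (ex_intro _ (ex_intro _ (ex_intro _ (And4 _ b _ _)))) := h in b)
  (fun phi s => @fill_pegs_step K s0 p0 w L K9 L100 nK limK s0K p0w p0s0 q0 phi s q0n) h0.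
have jE : j = size p0 by move: ng jn; rewrite sE /guard /= -/n; clear; lia.
rewrite sE in e s'X; rewrite jE take_size in hl'.
by exists t1, m', (n + j).*2.+2%:Z, a', t'; split=> //; move: ht1; clear; lia.
Qed.

Lemma counter_correct : exists t s,
  [/\ exe X L counter ([::], m0) t s, (t <= 600 * n + 200)%N &
    forall pc, outputs (conf pc s) (num_matchings nbs A0 F0)].
Proof.
have X1 := word_bound_gt1 K9.
have one_X : (`|1%R| <= X)%N by exact: ltnW.
have [|t1 [t [e1 [ht1 tK]]]] := @start_correct w n L m0 q0 (size p0) L100 m0X (fun j _ => m0w j) w0 wp.
  by rewrite /q0; move: size_p0; rewrite -/n; clear; lia.
rewrite -/K in e1 tK.
have [t2 [m1 [a1 [v1 [e2 ht2 b2 l1]]]]] := fill_cells_correct tK.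
have b3 : bounded X (fill_regs K s0 p0 n.*2.+2%:Z a1 v1 q0%:Z, m1).
  apply: (bounded_set_nth 14 b2).
  by apply: (le_word_bound_small K9); move: nK K9; clear; lia.
have e3 : exe X L (Block [:: Add 14 14 1]) (fill_regs K s0 p0 n.*2.+1%:Z a1 v1 q0%:Z, m1) 1
    (fill_regs K s0 p0 n.*2.+2%:Z a1 v1 q0%:Z, m1).
  have -> : (fill_regs K s0 p0 n.*2.+2%:Z a1 v1 q0%:Z, m1) = exec_block [:: Add 14 14 1]
      (fill_regs K s0 p0 n.*2.+1%:Z a1 v1 q0%:Z, m1).
    rewrite -[RHS]/(fill_regs K s0 p0 (n.*2.+1%:Z + 1) a1 v1 q0%:Z, m1).
    by have -> : n.*2.+1%:Z + 1 = n.*2.+2%:Z by clear; lia.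
  rewrite -[1%N]/(size [:: Add 14 14 1]).
  apply: (exe_block X1 _ _ b2); last exact: isT.
  by apply: leq_trans L100.
have [t4 [m2 [i2 [a2 [v2 [e4 ht4 b4 l2]]]]]] := fill_pegs_correct b3 l1.
pose r5 := regs K n.*2%:Z 1 a2 0 0 0 0 v2 0 1%N%:Z 0 q0%:Z 0%N%:Z lim%:Z.
have b5 : bounded X (r5, m2).
  exact: (bounded_set_nth 22 (bounded_set_nth 14 b4 one_X) one_X).
have e5 : exe X L (Block [:: Const 14 1; Const 22 1]) (fill_regs K s0 p0 i2 a2 v2 q0%:Z, m2) 2
    (r5, m2).
  rewrite -[(r5, m2)]/(exec_block [:: Const 14 1; Const 22 1] (fill_regs K s0 p0 i2 a2 v2 q0%:Z, m2)).
  rewrite -[2%N]/(size [:: Const 14 1; Const 22 1]).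
  apply: (exe_block X1 _ _ b4); last exact: isT.
  by apply: leq_trans L100.
have c5 : core K s0 p0 w F0 A0 q0 0 m2.
  split; [exact: l2|exact: fsubset_refl| |exact: card_F0|by rewrite mul1n|exact: q0n].
  (* As [n] is three times the number of pegs, there are two slots and two peg-free cells per
     peg. *)
  by rewrite card_A0 card_F0; move: size_p0; rewrite -/n; clear; lia.
have i5 : phase_inv s0 p0 1 0 F0 A0.
  by split=> // d _ []; rewrite ?take0.
have [t6 [F1 [A1 [q1 [k1 [m3 [i3 [a3 [x3 [deg3 [pe3 [pf3 [v3 [g3 [thr3]]]]]]]]]]]]]]] :=
  phase_correct (thr0 := 1) K9 L100 nK limK central s0w isT b5 c5 i5.
case=> e6 b6 c6 [deg6 _] ht6.
pose r7 := regs K n.*2%:Z 1 a3 x3 deg3 pe3 pf3 v3 g3 2%N%:Z thr3 q1%:Z k1%:Z lim%:Z.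
have two_X : (`|2%R| <= X)%N.
  by apply: (le_word_bound_small K9); move: K9; clear; lia.
have b7 : bounded X (r7, m3).
  exact: (bounded_set_nth 22 (bounded_set_nth 14 b6 one_X) two_X).
have e7 : exe X L (Block [:: Const 14 1; Const 22 2]) (regs K n.*2%:Z i3 a3 x3 deg3 pe3 pf3 v3 g3
    1%N%:Z thr3 q1%:Z k1%:Z lim%:Z, m3) 2 (r7, m3).
  rewrite -[(r7, m3)]/(exec_block [:: Const 14 1; Const 22 2] (regs K n.*2%:Z i3 a3 x3 deg3 pe3 pf3
    v3 g3 1%N%:Z thr3 q1%:Z k1%:Z lim%:Z, m3)).
  rewrite -[2%N]/(size [:: Const 14 1; Const 22 2]).
  apply: (exe_block X1 _ _ b6); last exact: isT.
  by apply: leq_trans L100.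
have F1s0 d : d \in F1 -> d \in s0.
  by move=> /(fsubsetP (core_F c6)) /F0_s0.
have i7 : phase_inv s0 p0 2 0 F1 A1.
  (* The first scan has visited every cell, so no degree 1 is left anywhere, as the second scan
     presupposes. *)
  split=> [d dF _|_]; last by right=> d; rewrite take0.
  by apply: deg6 => //; right; rewrite take_size; exact: F1s0.
have [t8 [F2 [A2 [q2 [k2 [m4 [i4 [a4 [x4 [deg4 [pe4 [pf4 [v4 [g4 [thr4]]]]]]]]]]]]]]] :=
  phase_correct (thr0 := 2) K9 L100 nK limK central s0w isT b7 c6 i7.
case=> e8 b8 c8 [_ dead8] ht8.
have kn := core_k c8.
have kK : k2.+1%:Z <= K + K by move: kn nK K9; rewrite -/n; clear; lia.
have [t9 [s9 [e9 ht9 out9]]] := output_correct K9 L100 kK b8.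
exists (t1 + (t2 + (1 + (t4 + (2 + (t6 + (2 + (t8 + t9))))))))%N, s9; split.
- exact: exe_seq e1 (exe_seq e2 (exe_seq e3 (exe_seq e4 (exe_seq e5 (exe_seq e6 (exe_seq e7
    (exe_seq e8 e9))))))).
- have k1n := core_k c6; move: ht1 ht2 ht4 ht6 ht8 ht9 k1n kn q0n; rewrite -/n.
  by move: size_p0; rewrite -/n; clear; lia.
- move=> pc; have := out9 pc; congr outputs; case: eqP => [q20|q20].
    have F20 : F2 = fset0 by apply/eqP; rewrite -cardfs_eq0 (core_q c8) q20.
    have A20 : A2 = fset0 by apply/eqP; rewrite -cardfs_eq0 (core_card c8) (core_q c8) q20.
    have := core_num c8; rewrite F20 A20 num_matchings0 muln1 => N0E.
    exact: esym N0E.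
  (* Cells are left although the second scan has visited all of them; its invariant allows this only
     if there is no matching. *)
  have [N00|dead] := dead8 erefl; first exact: esym N00.
  have /fset0Pn[d dF] : F2 != fset0.
    by rewrite -cardfs_eq0 (core_q c8); apply/eqP.
  have := dead d; rewrite take_size dF => h; have ds : d \in s0.
    exact: F0_s0 (fsubsetP (core_F c8) _ dF).
  by have := h ds.
Qed.

Lemma word_bound_input : (X <= (\max_(x <- w) `|x|%N + 2) ^ 15)%N.
Proof.
set B := \max_(x <- w) _.
have wB j : (`|nth 0%R w j| <= B)%N.
  have [jw|jw] := ltnP j (size w); last by rewrite nth_default.
  exact: (leq_bigmax_seq (F := fun x : int => `|x|%N) _ (mem_nth 0 jw) isT).
have nB : (n <= B)%N by have := wB 0%N.
have KB : K <= (B%:Z + 2) ^+ 4 by exact: quartic_bound nB (square_sum_bound _ wB).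
have Kn : (`|K| <= (B + 2) ^ 4)%N.
  rewrite -lez_nat -[(_ ^ _)%N%:Z]natz natrX natz PoszD gez0_abs //.
  by move: K9; clear; lia.
(* The factor 100 is at most [2 ^ 7], and each of the two factors [K] contributes an exponent 4. *)
rewrite /word_bound !abszM -[15%N]/(7 + (4 + 4))%N !expnD.
apply: leq_mul; last exact: leq_mul.
apply: (@leq_trans (2 ^ 7)); first by [].
by rewrite leq_exp2r // leq_addl.
Qed.

Lemma counter_computes :
  computes_within (compile 0 counter) (15 * 2 ^ L) (600 * n + 200) w (num_matchings nbs A0 F0).
Proof.
have [t [s [e ht out]]] := counter_correct.
exact: exe_computes e ht word_bound_input (out _).
Qed.

End Counter.

Theorem theorem1p2 (R : realType) :
  exists2 T : nat -> nat,
    (fun n : nat => (T n)%:R : R) =O_\oo (fun n : nat => n%:R : R) &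
    computable_in_time (@ptromino_n_n3 R) encodes (fun I => #|` I.1|%fset)
      (fun I => num_p_covers I.1 I.2) T.
Proof.
exists (fun n => 600 * n + 200)%N.
  (* For [n > 0], [600 * n + 200 <= 800 * n]. *)
  apply/eqO_exP; exists 800%:R; first by rewrite ltr0n.
  near=> n; rewrite !ger0_norm ?ler0n // -natrM ler_nat.
  have : (0 < n)%N by near: n; exists 1%N.
  by clear; lia.
(* The longest block has 56 instructions. The existential hides the value of [L], so that [2 ^ L] is
   not evaluated. *)
have [L L100] : exists L, (100 <= L)%N by exists 100%N.
exists (compile 0 counter), (15 * 2 ^ L)%N => -[S P] _ [_ PS /= cSP] [s [p [sS pP ->]]].
have sz : size s = #|` S|%fset by rewrite (perm_size sS).
have pz : size p = #|` P|%fset by rewrite (perm_size pP).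
have us : uniq s by rewrite (perm_uniq sS) fset_uniq.
have up : uniq p by rewrite (perm_uniq pP) fset_uniq.
have ps : {subset p <= s}.
  by move=> c; rewrite (perm_mem sS) (perm_mem pP); exact: (fsubsetP PS).
have szp : size s = (3 * size p)%N by rewrite sz pz.
rewrite -sz num_p_covers_matchings //.
have -> : P = [fset c in p]%fset.
  by apply/fsetP => c; rewrite !inE (perm_mem pP).
have -> : (S `\` [fset c in p])%fset = [fset c in s | c \notin p]%fset.
  by apply/fsetP => c; rewrite in_fsetD !inE /= (perm_mem sS) andbC.
exact: counter_computes.
Unshelve. all: by end_near.
Qed.
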